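(* Let $\Phi=(\phi_1,\dots,\phi_K)$ be a unit norm tight frame in $\mathbb{R}^d$ with frame constant $A=K/d$ and coherence $\mu$. Let signals be generated as $y=\Phi x+r$, where $r$ is a random noise vector independent of $x$ with $\|r\|_2\le\rho_{\max}$ almost surely, $\mathbb{E}(r)=0$ and $\mathbb{E}(rr^\star)=\rho^2 I$, and where $x$ is drawn from a symmetric probability distribution $\nu$ on $S^{K-1}$ with $\mathbb{E}_x\|x\|_\infty^2=\bar c_1^2$. Assume there exists $\beta<1/2$ such that $$\nu\Big(\frac{c_2(x)+\mu\|c(x)\|_1+\rho_{\max}}{c_1(x)-c_2(x)}\le\beta\Big)=1.$$ Then $\Phi$ is a local maximum of $\max_{\Psi\in\mathcal D}\mathbb{E}_y\|\Psi^\star y\|_\infty^2$, and for all $\Psi\in\mathcal D$ with $0<\max_i\|\psi_i-\phi_i\|_2\le\varepsilon$ we have $\mathbb{E}_y\|\Psi^\star y\|_\infty^2<\mathbb{E}_y\|\Phi^\star y\|_\infty^2$ as soon as $\varepsilon<1/5$ and $$\varepsilon\le\frac{(1-2\beta)^2}{2A\log\Big(2AK\big/\big(\bar c_1^2-\frac{1-\bar c_1^2}{K-1}\big)\Big)}.$$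
   Context: $\mathcal D$ is the set of dictionaries $\Psi=(\psi_1,\dots,\psi_K)$, $\psi_i\in\mathbb{R}^d$, $\|\psi_i\|_2=1$. Unit norm tight frame with frame constant $A$: $\sum_i|\langle\phi_i,v\rangle|^2=A\|v\|_2^2$ for all $v$; coherence $\mu=\max_{i\ne j}|\langle\phi_i,\phi_j\rangle|$. A probability measure $\nu$ on $S^{K-1}\subset\mathbb{R}^K$ is symmetric if it is invariant under flipping signs of any coordinates and under any permutation of coordinates. For $x\in S^{K-1}$, $c_1(x)\ge\dots\ge c_K(x)\ge0$ is the non-increasing rearrangement of $(|x_1|,\dots,|x_K|)$, $c(x)$ the resulting vector. *)

(* Defs.v *)
From HB Require Import structures.
From mathcomp Require Import all_boot all_order all_algebra.
From mathcomp Require Import all_classical all_reals all_analysis.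
From mathcomp Require Import fingroup perm.
Set Implicit Arguments. Unset Strict Implicit. Unset Printing Implicit Defensive.
Import Order.TTheory GRing.Theory Num.Theory.
Import numFieldNormedType.Exports.
Local Open Scope classical_set_scope.
Local Open Scope ring_scope.

Section Defs.
Variable R : realType.

(* A dictionary of K atoms in R^d is a d x K matrix whose columns are the atoms. *)
Definition atom_ip d K (Psi : 'M[R]_(d, K)) (i : 'I_K) (v : 'I_d -> R) : R :=
  \sum_(k < d) Psi k i * v k.

Definition l2norm d (v : 'I_d -> R) : R := Num.sqrt (\sum_(k < d) v k ^+ 2).

Definition is_dict d K (Psi : 'M[R]_(d, K)) : Prop :=
  forall i : 'I_K, l2norm (fun k => Psi k i) = 1.

Definition unit_norm_tight_frame d K (Phi : 'M[R]_(d, K)) (A : R) : Prop :=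
  is_dict Phi /\
  forall v : 'I_d -> R,
    \sum_(i < K) (atom_ip Phi i v) ^+ 2 = A * (l2norm v) ^+ 2.

Definition coherence d K (Phi : 'M[R]_(d, K)) : R :=
  \big[Num.max/0]_(i < K) \big[Num.max/0]_(j < K | j != i)
     `| atom_ip Phi i (fun k => Phi k j) |.

Definition dict_dist d K (Psi Phi : 'M[R]_(d, K)) : R :=
  \big[Num.max/0]_(i < K) l2norm (fun k => Psi k i - Phi k i).

Definition sup_sq d K (Psi : 'M[R]_(d, K)) (y : 'I_d -> R) : R :=
  \big[Num.max/0]_(i < K) (atom_ip Psi i y) ^+ 2.

Definition rearr K (x : 'I_K -> R) : seq R :=
  sort (fun a b : R => b <= a) [seq `|x i| | i <- enum 'I_K].
Definition c_ K (x : 'I_K -> R) (n : nat) : R := nth 0 (rearr x) n.-1.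
Definition c_l1 K (x : 'I_K -> R) : R := \sum_(i < K) `|x i|.

Section Prob.
Context {dT : measure_display} {T : measurableType dT}.
Variable P : probability T R.

Definition signal d K (Phi : 'M[R]_(d, K)) (X : 'I_K -> T -> R)
  (Rn : 'I_d -> T -> R) (w : T) : 'I_d -> R :=
  fun k => \sum_(i < K) Phi k i * X i w + Rn k w.

Definition objective d K (Psi Phi : 'M[R]_(d, K)) (X : 'I_K -> T -> R)
  (Rn : 'I_d -> T -> R) : \bar R :=
  (\int[P]_w (sup_sq Psi (signal Phi X Rn w))%:E)%E.

Definition box_event (n : nat) (F : 'I_n -> T -> R) (B : 'I_n -> set R) : set T :=
  [set w | forall i, B i (F i w)].

(* independence of the random vectors X and Rn (joint law = product law,
   tested on the generating pi-system of measurable boxes) *)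
Definition indep_vec d K (X : 'I_K -> T -> R) (Rn : 'I_d -> T -> R) : Prop :=
  forall (A : 'I_K -> set R) (B : 'I_d -> set R),
    (forall i, measurable (A i)) -> (forall k, measurable (B k)) ->
    P (box_event X A `&` box_event Rn B) = (P (box_event X A) * P (box_event Rn B))%E.

(* the law of X is symmetric: invariant under sign flips of any coordinates and
   under permutations of coordinates (laws compared on measurable boxes) *)
Definition symmetric_law K (X : 'I_K -> T -> R) : Prop :=
  forall (s : 'I_K -> bool) (sigma : {perm 'I_K}) (A : 'I_K -> set R),
    (forall i, measurable (A i)) ->
    P (box_event X A) =
    P (box_event (fun i w => (-1) ^+ s i * X (sigma i) w) A).

End Prob.
End Defs.

(* Main.v *)
(** Write [y = Phi x + r], [e_j = |psi_j - phi_j|], and let [i] be the position of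
    the largest coefficient of [x]. The separation condition makes [phi_i] beat
    every other atom of [Phi] on [y] by a margin proportional to [|x_i|], so
    [sup_j <phi_j, y>^2 = <phi_i, y>^2]. For a nearby dictionary,
    [sup_j <psi_j, y>^2] is at most [<psi_i, y>^2] plus the excesses
    [max(0, <psi_j, y>^2 - <psi_i, y>^2)], which are nonzero only when a
    Rademacher sum [sum_(l != i) +- x_l <psi_j - phi_j, phi_l>] is large:
    averaging over the signs of [x], a Chernoff bound makes each excess
    exponentially small in [1 / (e_i^2 + e_j^2)]. The term [i] is left out of the
    Rademacher sum because the other coefficients are at most half as large,
    which is what leaves room for [eps < 1/5].
    By sign and permutation invariance the main terms average to
    [E <psi_i, y>^2 = const + <psi_i, phi_i>^2 gamma] with
    [gamma = c1bar^2 - (1 - c1bar^2) / (K - 1)], and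
    [<psi_i, phi_i> = 1 - e_i^2 / 2], so the loss of order [gamma e_i^2]
    dominates all excesses. *)
Require Import Defs.
From HB Require Import structures.
From mathcomp Require Import all_boot all_order all_algebra.
From mathcomp Require Import all_classical all_reals all_analysis.
From mathcomp Require Import fingroup perm.
From mathcomp Require Import ring lra measurable_realfun.
Set Implicit Arguments. Unset Strict Implicit. Unset Printing Implicit Defensive.
Import Order.TTheory GRing.Theory Num.Theory.
Import numFieldNormedType.Exports.
Local Open Scope classical_set_scope.
Local Open Scope ring_scope.

(** * Rademacher sums *)

Section Rademacher.
Variable R : realType.

Lemma ge0_is_derive_le (f f' : R -> R) (b : R) : 0 <= b ->
  (forall x : R, is_derive x (1 : R) f (f' x)) ->
  (forall x, 0 <= x -> 0 <= f' x) -> f 0 <= f b.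
Proof.
move=> b0 df f'0.
have drv x : derivable f x 1 by have [] := df x.
apply: (@ger0_derive1_le_cc R f 0 b) => //.
- move=> x; rewrite in_itv/= => /andP[x0 _].
  have [_ dfx] := df x.
  by rewrite derive1E dfx; apply: f'0; exact: ltW.
- apply: continuous_subspaceT => x.
  by apply: differentiable_continuous; apply/derivable1_diffP.
- by rewrite in_itv/= lexx.
- by rewrite in_itv/= b0 lexx.
Qed.

(** Right side minus left side vanishes at 0 and has derivative [x * (expR x - expR (- x))],
    nonnegative for [0 <= x]. *)
Lemma sinh_le_mul_cosh (a : R) : 0 <= a ->
  expR a - expR (- a) <= a * (expR a + expR (- a)).
Proof.
move=> a0; rewrite -subr_ge0.
pose f (x : R) := x * (expR x + expR (- x)) - (expR x - expR (- x)).
pose f' (x : R) := x * (expR x - expR (- x)).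
have -> : 0 = f 0 by rewrite /f oppr0 mul0r subrr subr0.
apply: (@ge0_is_derive_le f f') => // x.
  by rewrite /f; apply: is_derive_eq; rewrite /f' /GRing.scale/= ; ring.
move=> x0; rewrite /f' mulr_ge0// subr_ge0 ler_expR; lra.
Qed.

(** By parity take [0 <= a]. Then [expR (- x^2 / 2) * cosh x] decreases on the half-line, since its
    derivative has the sign of [sinh x - x * cosh x]. *)
Lemma cosh_le_expR_sqr (a : R) :
  expR a + expR (- a) <= 2 * expR (a ^+ 2 / 2).
Proof.
wlog a0 : a / 0 <= a.
  move=> H; case: (leP 0 a) => [/H //|a0].
  rewrite addrC -{2}(opprK a) -(sqrrN a); apply: H; lra.
pose f (x : R) := - (expR (- (x ^+ 2 / 2)) * (expR x + expR (- x))).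
pose f' (x : R) := expR (- (x ^+ 2 / 2)) *
  (x * (expR x + expR (- x)) - (expR x - expR (- x))).
have : f 0 <= f a.
  apply: (@ge0_is_derive_le f f') => // x.
    by rewrite /f; apply: is_derive_eq; rewrite /f' /GRing.scale/= ; field.
  move=> x0; rewrite /f' mulr_ge0 ?expR_ge0// subr_ge0; exact: sinh_le_mul_cosh.
rewrite /f lerN2 expr0n/= mul0r oppr0 expR0 mul1r => H.
rewrite -ler_pdivrMr ?expR_gt0// -expRN mulrC; apply: le_trans H _; lra.
Qed.

Variable K : nat.
Implicit Types (a b : 'I_K -> R) (s : {ffun 'I_K -> bool}).

Definition sgn s (l : 'I_K) : R := (-1) ^+ s l.

(** The sum over sign patterns factorises into one [2 * cosh (a l)] per coordinate. This is the
    sub-Gaussian moment bound behind the Chernoff estimate. *)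
Lemma sum_expR_rademacher a :
  \sum_s expR (\sum_l sgn s l * a l) <= 2 ^+ K * expR (\sum_l a l ^+ 2 / 2).
Proof.
under eq_bigr do rewrite expR_sum.
rewrite -(bigA_distr_bigA (fun l (t : bool) => expR ((-1) ^+ t * a l))).
have -> : (2 : R) ^+ K = \prod_(l < K) 2 by rewrite prodr_const card_ord.
rewrite expR_sum -big_split/=.
apply: ler_prod => l _; rewrite big_bool/= expr0 expr1 mul1r mulN1r.
by rewrite addr_ge0 ?expR_ge0//= addrC cosh_le_expR_sqr.
Qed.

(** The exponential of [|u| + |v|] is at most the sum of the exponentials of the four signed
    combinations of [u] and [v], hence the factor 4. Each combination is again a Rademacher sum,
    whose half squared coefficients are at most [a l ^+ 2 + b l ^+ 2]. *)
Lemma sum_expR_abs_rademacher a b :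
  \sum_s expR (`|\sum_l sgn s l * a l| + `|\sum_l sgn s l * b l|)
  <= 2 ^+ K * (4 * expR (\sum_l (a l ^+ 2 + b l ^+ 2))).
Proof.
pose comb (t u : R) l := t * a l + u * b l.
have bnd t u : t ^+ 2 = 1 -> u ^+ 2 = 1 ->
    \sum_s expR (\sum_l sgn s l * comb t u l)
    <= 2 ^+ K * expR (\sum_l (a l ^+ 2 + b l ^+ 2)).
  move=> t1 u1; apply: le_trans (sum_expR_rademacher _) _.
  rewrite ler_pM2l ?exprn_gt0// ler_expR; apply: ler_sum => l _.
  have : 0 <= (t * a l - u * b l) ^+ 2 by exact: sqr_ge0.
  rewrite /comb sqrrB sqrrD !exprMn t1 u1; lra.
have E t u s : \sum_l sgn s l * comb t u l =
    t * (\sum_l sgn s l * a l) + u * (\sum_l sgn s l * b l).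
  rewrite !mulr_sumr -big_split; apply: eq_bigr => l _; rewrite /comb/=; ring.
have h1 : (-1 : R) ^+ 2 = 1 by rewrite sqrrN expr1n.
have h0 : (1 : R) ^+ 2 = 1 by rewrite expr1n.
have := bnd _ _ h0 h0; have := bnd _ _ h0 h1.
have := bnd _ _ h1 h0; have := bnd _ _ h1 h1.
move=> b1 b2 b3 b4.
apply: (@le_trans _ _ (\sum_s (expR (\sum_l sgn s l * comb (-1) (-1) l)
  + expR (\sum_l sgn s l * comb (-1) 1 l)
  + expR (\sum_l sgn s l * comb 1 (-1) l)
  + expR (\sum_l sgn s l * comb 1 1 l)))); last first.
  rewrite 3!big_split/= mulrCA.
  by move: b1 b2 b3 b4; move: (2 ^+ K * _) => Y; lra.
apply: ler_sum => s _; rewrite !E.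
move: (\sum_l _) (\sum_l _) => v u.
have := expR_ge0 (-1 * u + -1 * v); have := expR_ge0 (-1 * u + 1 * v).
have := expR_ge0 (1 * u + -1 * v); have := expR_ge0 (1 * u + 1 * v).
rewrite !mulN1r !mul1r.
case: (ger0P u) => _; case: (ger0P v) => _; lra.
Qed.

Definition flip (l : 'I_K) s : {ffun 'I_K -> bool} :=
  [ffun k => if k == l then ~~ s k else s k].

Lemma flipK l : involutive (flip l).
Proof.
by move=> s; apply/ffunP => k; rewrite !ffunE; case: eqP => // _; exact: negbK.
Qed.

Lemma sgn_flip l s k : sgn (flip l s) k = (if k == l then -1 else 1) * sgn s k.
Proof.
rewrite /sgn ffunE; case: eqP => // _; rewrite ?mul1r//.
by case: (s k); rewrite ?expr0 ?expr1; ring.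
Qed.

Lemma sgn_sqr s l : sgn s l ^+ 2 = 1.
Proof. by rewrite /sgn sqrr_sign. Qed.

(** Reindexing by the involution [flip l] shows that the sum equals its own opposite. *)
Lemma sum_sgn_odd l (f : {ffun 'I_K -> bool} -> R) :
  (forall s, f (flip l s) = - f s) -> \sum_s f s = 0.
Proof.
move=> fN; have : \sum_s f s = - \sum_s f s.
  rewrite {1}(reindex (flip l)) /=; last by exists (flip l) => s _; exact: flipK.
  by rewrite -sumrN; apply: eq_bigr => s _; rewrite fN.
lra.
Qed.

(** The linear term and the mixed products are odd under a single flip, so only the squares
    survive. *)
Lemma sum_sqr_rademacher a (b : R) :
  \sum_s (\sum_l sgn s l * a l + b) ^+ 2 = 2 ^+ K * (\sum_l a l ^+ 2 + b ^+ 2).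
Proof.
have E s : (\sum_l sgn s l * a l + b) ^+ 2 =
    \sum_l \sum_m sgn s l * sgn s m * (a l * a m)
    + 2 * b * (\sum_l sgn s l * a l) + b ^+ 2.
  have -> : \sum_l \sum_m sgn s l * sgn s m * (a l * a m) =
      (\sum_l sgn s l * a l) * (\sum_l sgn s l * a l).
    rewrite mulr_suml; apply: eq_bigr => l _; rewrite mulr_sumr.
    by apply: eq_bigr => m _; ring.
  ring.
have card : #|{: {ffun 'I_K -> bool}}| = (2 ^ K)%N.
  by rewrite card_ffun card_bool card_ord.
under eq_bigr do rewrite E.
rewrite !big_split/= sumr_const card -[_ *+ (2 ^ K)%N]mulr_natl natrX.
rewrite -mulr_sumr [X in _ + _ * X + _]exchange_big/=.
rewrite [X in _ + _ * X + _]big1 ?mulr0 ?addr0; last first.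
  by move=> l _; apply: (@sum_sgn_odd l) => s; rewrite sgn_flip eqxx; ring.
rewrite mulrDr; congr (_ + _).
rewrite exchange_big/= mulr_sumr; apply: eq_bigr => l _.
rewrite exchange_big/= (bigD1 l)//= [X in _ + X]big1 ?addr0; last first.
  move=> m ml; apply: (@sum_sgn_odd l) => s; rewrite !sgn_flip eqxx (negbTE ml); ring.
under eq_bigr do rewrite -expr2 sgn_sqr mul1r -expr2.
by rewrite sumr_const card -[_ *+ (2 ^ K)%N]mulr_natl natrX.
Qed.

End Rademacher.

(** * Frames and the excess over the dominant atom *)

Section LinearAlgebra.
Variables (R : realType) (d : nat).
Implicit Types u v : 'I_d -> R.

(** [atom_ip Phi i v] is convertible to [ip (Phi^~ i) v]; this form also accepts differences of
    atoms. *)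
Definition ip u v : R := \sum_k u k * v k.

Lemma ipC u v : ip u v = ip v u.
Proof. by apply: eq_bigr => k _; rewrite mulrC. Qed.

Lemma ipBl u v w : ip (fun k => u k - v k) w = ip u w - ip v w.
Proof. by rewrite -sumrB; apply: eq_bigr => k _; rewrite mulrBl. Qed.

Lemma l2norm_ge0 v : 0 <= l2norm v.
Proof. exact: sqrtr_ge0. Qed.

Lemma l2norm_sqr v : l2norm v ^+ 2 = ip v v.
Proof.
rewrite sqr_sqrtr ?sumr_ge0//; last by move=> k _; exact: sqr_ge0.
Qed.

(** Cauchy-Schwarz by Lagrange's identity: the double sum of squares is twice the right side minus
    the left side. *)
Lemma ip_sqr_le u v : ip u v ^+ 2 <= ip u u * ip v v.
Proof.
have : 0 <= \sum_k \sum_l (u k * v l - u l * v k) ^+ 2.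
  by apply: sumr_ge0 => k _; apply: sumr_ge0 => l _; exact: sqr_ge0.
have -> : \sum_k \sum_l (u k * v l - u l * v k) ^+ 2 =
    \sum_k \sum_l (u k * u k) * (v l * v l)
    + \sum_k \sum_l (v k * v k) * (u l * u l)
    - 2 * \sum_k \sum_l (u k * v k) * (u l * v l).
  rewrite mulr_sumr -big_split -sumrB; apply: eq_bigr => k _ /=.
  rewrite mulr_sumr -big_split -sumrB; apply: eq_bigr => l _ /=; ring.
have sum2 (f g : 'I_d -> R) :
    \sum_k \sum_l f k * g l = (\sum_k f k) * (\sum_l g l).
  by rewrite mulr_suml; apply: eq_bigr => k _; rewrite mulr_sumr.
rewrite !sum2 -/(ip u u) -/(ip v v) -/(ip u v); lra.
Qed.

Lemma ip_le_norm u v : `|ip u v| <= l2norm u * l2norm v.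
Proof.
rewrite -(@ler_pXn2r _ 2)// ?nnegrE ?mulr_ge0 ?l2norm_ge0//.
by rewrite real_normK ?num_real// exprMn !l2norm_sqr ip_sqr_le.
Qed.

End LinearAlgebra.

Section Frame.
Variables (R : realType) (d K : nat).
Implicit Types (Phi Psi : 'M[R]_(d, K)) (x : 'I_K -> R) (r : 'I_d -> R).

(** The signal for one realisation of coefficients and noise; [signal] at a sample point unfolds to
    it. *)
Definition synth Phi x r : 'I_d -> R := fun k => \sum_i Phi k i * x i + r k.

Lemma ip_synth Phi x r u :
  ip u (synth Phi x r) = \sum_l x l * atom_ip Phi l u + ip u r.
Proof.
rewrite /ip /synth; under eq_bigr do rewrite mulrDr mulr_sumr.
rewrite big_split/=; congr (_ + _).
rewrite exchange_big/=; apply: eq_bigr => l _; rewrite /atom_ip mulr_sumr.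
by apply: eq_bigr => k _; ring.
Qed.

Definition atom_diff Psi Phi (i : 'I_K) : 'I_d -> R := fun k => Psi k i - Phi k i.

Lemma dict_ip1 Phi i : is_dict Phi -> ip (Phi^~ i) (Phi^~ i) = 1.
Proof. by move=> /(_ i) h; rewrite -l2norm_sqr h expr1n. Qed.

(** Polarisation for unit vectors. *)
Lemma atom_ip_diff Psi Phi i : is_dict Psi -> is_dict Phi ->
  atom_ip Phi i (Psi^~ i) = 1 - l2norm (atom_diff Psi Phi i) ^+ 2 / 2.
Proof.
move=> hPsi hPhi; rewrite l2norm_sqr.
have -> : ip (atom_diff Psi Phi i) (atom_diff Psi Phi i) =
    ip (Psi^~ i) (Psi^~ i) - 2 * ip (Phi^~ i) (Psi^~ i) + ip (Phi^~ i) (Phi^~ i).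
  rewrite /ip /atom_diff mulr_sumr -sumrB -big_split/=.
  by apply: eq_bigr => k _; ring.
rewrite !dict_ip1// /ip /atom_ip; lra.
Qed.

Lemma coherence_ge0 Phi : 0 <= coherence Phi.
Proof. exact: bigmax_ge_id. Qed.

Lemma coherence_le Phi i j : j != i ->
  `|atom_ip Phi i (Phi^~ j)| <= coherence Phi.
Proof.
move=> ji; rewrite /coherence.
apply: le_trans (le_bigmax _ _ i).
exact: (@le_bigmax_cond _ _ _ _ j (fun j => j != i)
  (fun j => `|atom_ip Phi i (Phi^~ j)|)).
Qed.

(** Unit norm makes the diagonal term exactly [x i]. The other atoms contribute at most the
    coherence times their coefficients, and the noise is handled by Cauchy-Schwarz. *)
Lemma frame_coef_dist Phi x r i : is_dict Phi ->
  `|ip (Phi^~ i) (synth Phi x r) - x i| <= coherence Phi * c_l1 x + l2norm r.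
Proof.
move=> hPhi; rewrite ip_synth (bigD1 i)//=.
have -> : atom_ip Phi i (Phi^~ i) = 1 by exact: dict_ip1.
rewrite mulr1; set S := \sum_(_ | _) _.
have -> : x i + S + ip (Phi^~ i) r - x i = S + ip (Phi^~ i) r by ring.
apply: le_trans (ler_normD _ _) _; apply: lerD; last first.
  by apply: le_trans (ip_le_norm _ _) _; rewrite hPhi mul1r.
apply: le_trans (ler_norm_sum _ _ _) _.
rewrite /c_l1 mulr_sumr [leRHS](bigD1 i)//=.
rewrite -[leLHS]add0r; apply: lerD; first by rewrite mulr_ge0 ?coherence_ge0.
apply: ler_sum => l li; rewrite normrM mulrC ler_wpM2r//.
have -> : atom_ip Phi l (Phi^~ i) = atom_ip Phi i (Phi^~ l) by exact: ipC.
exact: coherence_le.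
Qed.

(** Used with [eta = 1 - 2 * beta] and [q = c2 / c]; [tau] is then the margin of the dominant atom
    relative to [c]. The bound by [3 * eta * q] controls the variance in the Chernoff estimate, and
    [tau <= 1] limits the constant lost in [excess_le]. *)
Lemma threshold_bounds (eta q eps : R) : 0 < eta -> eta <= 1 -> 0 <= q ->
  q <= (1 - eta) / 2 -> 0 <= eps -> eps < 1 / 5 -> 2 * eps <= eta ^+ 2 ->
  let tau := eta + (2 - eta) * q - eps * (3 - eta) in
  [/\ 3 * eta * q <= tau, 0 < tau & tau <= 1].
Proof.
move=> e0 e1 q0 q1 p0 p1 pe tau; rewrite /tau.
have a : eps * (3 - eta) <= 3 / 4 * eta.
  (* For small [eta] the bound [eps <= eta^2 / 2] suffices as long as [eta * (3 - eta) <= 3 / 2],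
     that is up to about 0.634. For large [eta] the bound [eps < 1 / 5] suffices from about 0.632
     on. The cut lies between the two. *)
  case: (lerP eta (633 / 1000)) => h; last by nra.
  have : 2 * eps * (3 - eta) <= eta ^+ 2 * (3 - eta) by rewrite ler_wpM2r//; lra.
  have : eta * (3 - eta) <= 3 / 2 by nra.
  have -> : eta ^+ 2 * (3 - eta) = eta * (eta * (3 - eta)) by ring.
  move=> h1; have : eta * (eta * (3 - eta)) <= eta * (3 / 2); last by lra.
  by rewrite ler_wpM2l// ltW.
have qe : 0 <= (2 - eta) * q by rewrite mulr_ge0//; lra.
have qe' : (2 - eta) * q <= (2 - eta) * ((1 - eta) / 2) by rewrite ler_wpM2l//; lra.
have pe0 : 0 <= eps * (3 - eta) by rewrite mulr_ge0//; lra.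
split; [|lra|nra].
suff : 0 <= eta / 4 + (2 - 4 * eta) * q by lra.
case: (lerP eta (1 / 2)) => h; first by rewrite addr_ge0 ?mulr_ge0//; lra.
have : (4 * eta - 2) * q <= (4 * eta - 2) * ((1 - eta) / 2) by rewrite ler_wpM2l//; lra.
(* At the extreme value of [q] there remains the quadratic [2 * eta^2 - 11 / 4 * eta + 1], whose
   minimum, at [11 / 16], is [7 / 128]. *)
have := sqr_ge0 (eta - 11 / 16); lra.
Qed.

(* [tau * c] is the margin of the dominant atom left after the perturbation; an
   excess occurs only if the fluctuations [Di + Dj] exceed it. *)
Lemma excess_le (beta eps rho c c2 fi fj Di Dj u w lam : R) :
  0 < c -> 0 <= beta -> beta < 1 / 2 -> 0 <= c2 -> 0 <= eps -> eps < 1 / 5 ->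
  rho <= beta * c -> c + c2 - beta * (c - c2) <= fi ->
  fj <= beta * (c - c2) -> 0 <= Di -> 0 <= Dj ->
  `|u| <= fj + (eps * c + Dj + eps * rho) ->
  fi - (eps * c + Di + eps * rho) <= `|w| ->
  let tau := (1 - 2 * beta) + (2 - (1 - 2 * beta)) * (c2 / c)
             - eps * (3 - (1 - 2 * beta)) in
  tau <= 1 -> 2 <= lam ->
  u ^+ 2 - w ^+ 2 <= c ^+ 2 * (expR 2 * expR (lam * ((Di + Dj) / c - tau))).
Proof.
move=> c0 b0 b1 c20 p0 p1 rb hfi hfj Di0 Dj0 hu hw tau tau1 lam2.
set m := (Di + Dj) / c.
have rhs0 : 0 <= c ^+ 2 * (expR 2 * expR (lam * (m - tau))).
  by rewrite mulr_ge0 ?sqr_ge0// mulr_ge0 ?expR_ge0.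
have erho : eps * rho <= eps * (beta * c) by rewrite ler_wpM2l.
have mc : m * c = Di + Dj by rewrite /m divfK// gt_eqF.
case: (lerP `|u| `|w|) => [uw|wu].
  apply: le_trans rhs0; rewrite subr_le0 -(real_normK (num_real u)) -(real_normK (num_real w)).
  by rewrite ler_pXn2r ?nnegrE.
have tc : tau * c = (1 - 2 * beta) * c + (2 - (1 - 2 * beta)) * c2
             - eps * (3 - (1 - 2 * beta)) * c.
  by rewrite /tau; field; rewrite gt_eqF.
(* Chaining the bounds on [u] and [w] through [|w| < |u|] and dividing by [c] yields exactly the
   expression defining [tau]. *)
have taum : tau <= m.
  rewrite -(ler_pM2r c0) mc tc; lra.
have um : `|u| <= c * expR m.
  apply: (@le_trans _ _ (c * (1 + m))); last by rewrite ler_wpM2l ?expR_ge1Dx// ltW.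
  rewrite mulrDr mulr1 [c * m]mulrC mc.
  have : eps * (beta * c) <= 1 / 5 * (beta * c).
    by rewrite ler_wpM2r ?mulr_ge0//; lra.
  have : eps * c <= 1 / 5 * c by rewrite ler_wpM2r//; lra.
  have : beta * c <= 1 / 2 * c by rewrite ler_wpM2r//; lra.
  have : 0 <= beta * c2 by rewrite mulr_ge0.
  lra.
have : u ^+ 2 - w ^+ 2 <= (c * expR m) ^+ 2.
  rewrite lerBlDr -[leLHS]addr0; apply: lerD; last exact: sqr_ge0.
  rewrite -(real_normK (num_real u)) ler_pXn2r ?nnegrE// mulr_ge0 ?expR_ge0// ltW//.
move=> /le_trans; apply; rewrite exprMn ler_wpM2l ?sqr_ge0//.
rewrite expr2 -!expRD ler_expR.
(* Together with [tau <= 1] this gives [2 * m <= 2 + lam * (m - tau)], which is where the factor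
   [expR 2] comes from. *)
have : 0 <= (lam - 2) * (m - tau) by rewrite mulr_ge0//; lra.
lra.
Qed.

End Frame.

(** * Sign-averaged excess for a fixed realisation with dominant index [i] *)

Section Excess.
Variables (R : realType) (d K : nat) (Phi Psi : 'M[R]_(d, K)) (A : R).
Hypotheses (frame : unit_norm_tight_frame Phi A) (A1 : 1 <= A).
Variables (beta eps rho : R).
Hypotheses (beta0 : 0 <= beta) (beta_lt : beta < 1 / 2).
Hypotheses (eps_lt : eps < 1 / 5) (eps_le : 2 * A * eps <= (1 - 2 * beta) ^+ 2).

Local Notation e j := (l2norm (atom_diff Psi Phi j)).
Hypothesis (e_le : forall j, e j <= eps).

Variables (x : 'I_K -> R) (r : 'I_d -> R) (i : 'I_K) (c c2 : R).
Hypotheses (c20 : 0 <= c2) (xi : `|x i| = c) (c2_lt : c2 < c).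
Hypothesis x_le : forall l : 'I_K, l != i -> `|x l| <= c2.
Hypothesis sep : c2 + coherence Phi * c_l1 x + rho <= beta * (c - c2).
Hypothesis r_le : l2norm r <= rho.

Definition signed (s : {ffun 'I_K -> bool}) : 'I_K -> R := fun l => sgn R s l * x l.

Lemma normr_signed s l : `|signed s l| = `|x l|.
Proof. by rewrite /signed normrM /sgn normrX normrN1 expr1n mul1r. Qed.

Lemma c_l1_signed s : c_l1 (signed s) = c_l1 x.
Proof. by apply: eq_bigr => l _; rewrite normr_signed. Qed.

Let y s := synth Phi (signed s) r.
Let g j l := atom_ip Phi l (atom_diff Psi Phi j).
(** Coefficients of the Rademacher part of [<psi_j - phi_j, y>]. The dominant index is zeroed
    because its term is bounded directly by [e j * c]. *)
Let a (j l : 'I_K) : R := if l == i then 0 else x l * g j l.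

Let c_gt0 : 0 < c. Proof. exact: le_lt_trans c2_lt. Qed.

Let dictPhi : is_dict Phi. Proof. by case: frame. Qed.

Local Ltac slra := move: beta0 beta_lt eps_lt eps_le c20 c2_lt sep r_le A1; lra.

Lemma dominant_coef_ge s :
  c + c2 - beta * (c - c2) <= `|ip (Phi^~ i) (y s)|.
Proof.
have := frame_coef_dist (signed s) r i dictPhi.
rewrite distrC c_l1_signed => /(le_trans (lerB_dist _ _)).
rewrite normr_signed xi -/(y s); slra.
Qed.

Lemma other_coef_le s j : j != i ->
  `|ip (Phi^~ j) (y s)| <= beta * (c - c2).
Proof.
move=> ji.
have := frame_coef_dist (signed s) r j dictPhi.
rewrite c_l1_signed => /(le_trans (lerB_dist _ _)).
have := x_le ji; rewrite normr_signed -/(y s); slra.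
Qed.

Lemma rho_le : rho <= beta * c.
Proof.
have : 0 <= coherence Phi * c_l1 x by rewrite mulr_ge0 ?coherence_ge0 ?sumr_ge0.
have : 0 <= beta * c2 by rewrite mulr_ge0.
by slra.
Qed.

Lemma c2_le : c2 <= beta * c.
Proof.
have : 0 <= coherence Phi * c_l1 x by rewrite mulr_ge0 ?coherence_ge0 ?sumr_ge0.
have : 0 <= beta * c2 by rewrite mulr_ge0.
have : 0 <= rho by apply: le_trans r_le; exact: l2norm_ge0.
by slra.
Qed.

Lemma diff_coef_le s j :
  `|ip (atom_diff Psi Phi j) (y s)| <=
  e j * c + `|\sum_l sgn R s l * a j l| + e j * rho.
Proof.
rewrite ip_synth (bigD1 i)//= [X in _ + `|X| + _](bigD1 i)//= [a j i]/a eqxx mulr0 add0r.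
have -> : \sum_(l | l != i) signed s l * atom_ip Phi l (atom_diff Psi Phi j) =
    \sum_(l | l != i) sgn R s l * a j l.
  by apply: eq_bigr => l li; rewrite /a (negbTE li) /g /signed mulrA.
apply: le_trans (ler_normD _ _) _; apply: lerD.
  apply: le_trans (ler_normD _ _) _; apply: lerD => //.
  rewrite normrM normr_signed xi mulrC ler_wpM2r ?(ltW c_gt0)//.
  have := ip_le_norm (Phi^~ i) (atom_diff Psi Phi j).
  by rewrite dictPhi mul1r.
by apply: le_trans (ip_le_norm _ _) _; rewrite ler_wpM2l ?l2norm_ge0.
Qed.

(** The tight frame identity applied to [psi_j - phi_j] gives [A * e j ^+ 2]; every coefficient kept
    is at most [c2]. This is the variance proxy of the Chernoff bound. *)
Lemma sum_sqr_a j : \sum_l a j l ^+ 2 <= c2 ^+ 2 * (A * e j ^+ 2).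
Proof.
have [_ <-] := frame; rewrite mulr_sumr; apply: ler_sum => l _.
rewrite /a; case: eqP => [_|/eqP li].
  by rewrite expr0n/= mulr_ge0// sqr_ge0.
rewrite exprMn ler_wpM2r ?sqr_ge0// -(real_normK (num_real (x l))).
by rewrite ler_pXn2r ?nnegrE// x_le.
Qed.

Let exc s j := Num.max 0 (ip (Psi^~ j) (y s) ^+ 2 - ip (Psi^~ i) (y s) ^+ 2).

Lemma ip_Psi s j :
  ip (Psi^~ j) (y s) = ip (Phi^~ j) (y s) + ip (atom_diff Psi Phi j) (y s).
Proof. by rewrite ipBl addrC subrK. Qed.

(** The hypothesis on [kappa] isolates the exponential rate produced by the Chernoff bound, so that
    the numerical comparison can be made separately. The 4 comes from the two absolute values and
    [expR 2] from the pointwise bound. *)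
Lemma sum_excess_le kappa j : j != i ->
  (let E2 := e i ^+ 2 + e j ^+ 2 in 0 < E2 ->
   4 * (expR 2 * expR (- (9 * (1 - 2 * beta) ^+ 2 / (4 * A * E2)))) <= kappa * E2) ->
  \sum_s exc s j <= 2 ^+ K * (x i ^+ 2 * (kappa * (e i ^+ 2 + e j ^+ 2))).
Proof.
move=> ji /=; set E2 := _ + _ => hE2.
have ei0 := l2norm_ge0 (atom_diff Psi Phi i).
have ej0 := l2norm_ge0 (atom_diff Psi Phi j).
have eps0 : 0 <= eps by apply: le_trans (e_le i).
have cE : c ^+ 2 = x i ^+ 2 by rewrite -xi real_normK// num_real.
have E20 : 0 <= E2 by rewrite addr_ge0// sqr_ge0.
pose tau := (1 - 2 * beta) + (2 - (1 - 2 * beta)) * (c2 / c)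
             - eps * (3 - (1 - 2 * beta)).
have [tau3 tau0 tau1] : [/\ 3 * (1 - 2 * beta) * (c2 / c) <= tau, 0 < tau & tau <= 1].
  apply: threshold_bounds => //.
  - slra.
  - slra.
  - by rewrite divr_ge0// ltW.
  - by rewrite ler_pdivrMr//; have := c2_le; slra.
  - have : 0 <= (A - 1) * eps by rewrite mulr_ge0//; slra.
    by slra.
have rho0 : 0 <= rho by apply: le_trans r_le; exact: l2norm_ge0.
have excle lam s : 2 <= lam -> exc s j <= c ^+ 2 * (expR 2 *
    expR (lam * ((`|\sum_l sgn R s l * a i l| + `|\sum_l sgn R s l * a j l|) / c - tau))).
  move=> lam2; rewrite /exc ge_max; apply/andP; split.
    by rewrite mulr_ge0 ?sqr_ge0// mulr_ge0 ?expR_ge0.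
  have erho k : e k * rho <= eps * rho by rewrite ler_wpM2r.
  have ec k : e k * c <= eps * c by rewrite ler_wpM2r// ltW.
  apply: (@excess_le R beta eps rho c c2 `|ip (Phi^~ i) (y s)| `|ip (Phi^~ j) (y s)|) => //.
  - exact: rho_le.
  - exact: dominant_coef_ge.
  - exact: other_coef_le.
  - rewrite ip_Psi; apply: le_trans (ler_normD _ _) _.
    have := diff_coef_le s j; have := erho j; have := ec j; slra.
  - rewrite ip_Psi; have := lerB_normD (ip (Phi^~ i) (y s)) (ip (atom_diff Psi Phi i) (y s)).
    have := diff_coef_le s i; have := erho i; have := ec i; slra.
have [E2z|E2p] : E2 = 0 \/ 0 < E2.
- by move: E20; rewrite le_eqVlt => /orP[/eqP <-|]; [left|right].
(* If [E2] vanishes, neither atom has moved, and atom [i] beats atom [j] on every signed signal. *)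
- have z (b : R) : b ^+ 2 <= E2 -> b = 0.
    by rewrite E2z => h; apply/eqP; rewrite -sqrf_eq0 eq_le h sqr_ge0.
  have ei : e i = 0 by apply: z; rewrite lerDl sqr_ge0.
  have ej : e j = 0 by apply: z; rewrite lerDr sqr_ge0.
  have ip0 k s : e k = 0 -> ip (Psi^~ k) (y s) = ip (Phi^~ k) (y s).
    move=> ek; rewrite ip_Psi; have := ip_le_norm (atom_diff Psi Phi k) (y s).
    by rewrite ek mul0r normr_le0 => /eqP ->; rewrite addr0.
  rewrite E2z !mulr0 big1// => s _; rewrite /exc !ip0//; apply/max_idPl.
  rewrite subr_le0 -(real_normK (num_real (ip _ _))) -[leRHS](real_normK (num_real _)).
  rewrite ler_pXn2r ?nnegrE//.
  have := dominant_coef_ge s; have := other_coef_le s ji.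
  have : beta * (c - c2) <= 1 / 2 * (c - c2).
    by rewrite ler_wpM2r ?subr_ge0 ?ltW//.
  have := c2_lt; slra.
have A0 : 0 < A by slra.
have E2le : E2 <= 2 * eps ^+ 2.
  have : e i ^+ 2 <= eps ^+ 2 by rewrite ler_pXn2r ?nnegrE.
  have : e j ^+ 2 <= eps ^+ 2 by rewrite ler_pXn2r ?nnegrE.
  rewrite /E2; slra.
have eps_gt0 : 0 < eps.
  rewrite lt_neqAle eps0 andbT; apply/eqP => e0; move: E2le; rewrite -e0 expr0n/=; slra.
(* Chernoff: [Lam = lam * tau] minimises [(lam / (3 eta))^2 tau^2 A E2 - lam tau]. *)
pose Lam := 9 * (1 - 2 * beta) ^+ 2 / (2 * A * E2).
(* Follows from [E2 <= 2 * eps^2], [2 * A * eps <= (1 - 2 * beta)^2] and [eps < 1 / 5]; since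
   [tau <= 1] it passes to [lam], as [excess_le] requires. *)
have Lam2 : 2 <= Lam.
  rewrite ler_pdivlMr ?mulr_gt0//.
  have : A * E2 <= A * (2 * eps ^+ 2) by rewrite ler_pM2l.
  have : A * eps * eps <= A * eps * (1 / 5).
    by rewrite ler_wpM2l ?mulr_ge0 ?ltW//.
  move: eps_le (sqr_ge0 (1 - 2 * beta)); move: ((1 - 2 * beta) ^+ 2) => h.
  rewrite (expr2 eps); lra.
pose lam := Lam / tau.
have lam2 : 2 <= lam.
  by apply: (le_trans Lam2); rewrite ler_pdivlMr// ler_piMr// (le_trans _ Lam2).
have lam0 : 0 <= lam by apply: (le_trans _ lam2).
apply: le_trans (ler_sum _ (fun s _ => excle lam s lam2)) _.
rewrite -mulr_sumr cE mulrCA ler_wpM2l ?sqr_ge0//.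
have -> : \sum_s (expR 2 * expR (lam * ((`|\sum_l sgn R s l * a i l| +
      `|\sum_l sgn R s l * a j l|) / c - tau))) =
    expR 2 * expR (- Lam) * \sum_s expR (`|\sum_l sgn R s l * (lam / c * a i l)| +
      `|\sum_l sgn R s l * (lam / c * a j l)|).
  rewrite mulr_sumr; apply: eq_bigr => s _; rewrite -!expRD; congr expR.
  have lc0 : 0 <= lam / c by rewrite divr_ge0// ltW.
  have sc k : `|\sum_l sgn R s l * (lam / c * a k l)| = lam / c * `|\sum_l sgn R s l * a k l|.
    rewrite -{2}(ger0_norm lc0) -normrM mulr_sumr; congr Num.norm.
    by apply: eq_bigr => l _; rewrite mulrCA.
  rewrite !sc /lam; field; rewrite !gt_eqF//.
apply: le_trans (ler_wpM2l _ (sum_expR_abs_rademacher _ _)) _.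
  by rewrite mulr_ge0 ?expR_ge0.
rewrite mulrCA ler_wpM2l ?exprn_ge0//.
apply: le_trans _ (hE2 E2p).
rewrite mulrCA ler_wpM2l// -[leLHS]mulrA ler_wpM2l ?expR_ge0// -expRD ler_expR.
have -> : - (9 * (1 - 2 * beta) ^+ 2 / (4 * A * E2)) = - Lam + Lam / 2.
  by rewrite /Lam; field; rewrite !gt_eqF.
rewrite lerD2l.
have -> : \sum_l ((lam / c * a i l) ^+ 2 + (lam / c * a j l) ^+ 2) =
    (lam / c) ^+ 2 * (\sum_l a i l ^+ 2 + \sum_l a j l ^+ 2).
  rewrite -big_split mulr_sumr/=; apply: eq_bigr => l _; ring.
have := sum_sqr_a i; have := sum_sqr_a j => hj hi.
apply: (@le_trans _ _ ((lam / c) ^+ 2 * (c2 ^+ 2 * (A * E2)))).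
  rewrite ler_wpM2l ?sqr_ge0// /E2; slra.
have -> : (lam / c) ^+ 2 * (c2 ^+ 2 * (A * E2)) = (lam * (c2 / c)) ^+ 2 * (A * E2).
  by field; rewrite gt_eqF.
have eta0 : 0 < 1 - 2 * beta by slra.
(* The lower bound on [tau] replaces [lam * (c2 / c)] by [Lam / (3 * eta)], with
   [eta = 1 - 2 * beta]; by the choice of [Lam] the new exponent is exactly [Lam / 2]. *)
apply: (@le_trans _ _ ((Lam / (3 * (1 - 2 * beta))) ^+ 2 * (A * E2))).
  rewrite ler_wpM2r ?mulr_ge0 ?(ltW A0)//.
  have h1 : 0 <= lam * (c2 / c) by rewrite mulr_ge0// divr_ge0// ltW.
  have h2 : 0 <= Lam / (3 * (1 - 2 * beta)).
    by rewrite divr_ge0 ?(le_trans _ Lam2)// mulr_ge0// ltW.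
  rewrite ler_pXn2r ?nnegrE//.
  rewrite ler_pdivlMr ?mulr_gt0//.
  have -> : lam * (c2 / c) * (3 * (1 - 2 * beta)) = lam * (3 * (1 - 2 * beta) * (c2 / c)) by ring.
  have -> : Lam = lam * tau by rewrite /lam divfK// gt_eqF.
  by rewrite ler_wpM2l.
rewrite le_eqVlt; apply/orP; left; apply/eqP; rewrite /Lam; field.
by rewrite !gt_eqF.
Qed.

Lemma sup_sq_le s : sup_sq Psi (y s) <=
  ip (Psi^~ i) (y s) ^+ 2 + \sum_(j | j != i) exc s j.
Proof.
have exc0 j : 0 <= exc s j by rewrite /exc le_max lexx.
apply: bigmax_le => [|j _]; first by rewrite addr_ge0 ?sqr_ge0 ?sumr_ge0.
have [->|ji] := eqVneq j i; first by rewrite lerDl sumr_ge0.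
rewrite -lerBlDl (bigD1 j)//=; apply: (@le_trans _ _ (exc s j)).
  by rewrite /exc le_max lexx orbT.
by rewrite lerDl sumr_ge0.
Qed.

(** The square at the dominant atom averages exactly by orthogonality of the signs; all other atoms
    enter only through their excesses. *)
Lemma sum_sup_sq_le kappa :
  (forall j, j != i -> let E2 := e i ^+ 2 + e j ^+ 2 in 0 < E2 ->
   4 * (expR 2 * expR (- (9 * (1 - 2 * beta) ^+ 2 / (4 * A * E2)))) <= kappa * E2) ->
  \sum_s sup_sq Psi (y s) <= 2 ^+ K *
   (\sum_l x l ^+ 2 * atom_ip Phi l (Psi^~ i) ^+ 2 + ip (Psi^~ i) r ^+ 2
    + x i ^+ 2 * \sum_(j | j != i) kappa * (e i ^+ 2 + e j ^+ 2)).
Proof.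
move=> hk; apply: le_trans (ler_sum _ (fun s _ => sup_sq_le s)) _.
rewrite big_split/= exchange_big/= mulrDr; apply: lerD.
  have -> : \sum_s ip (Psi^~ i) (y s) ^+ 2 =
      \sum_s (\sum_l sgn R s l * (x l * atom_ip Phi l (Psi^~ i)) + ip (Psi^~ i) r) ^+ 2.
    apply: eq_bigr => s _; rewrite ip_synth; congr ((_ + _) ^+ 2).
    by apply: eq_bigr => l _; rewrite mulrA.
  rewrite sum_sqr_rademacher ler_pM2l ?exprn_gt0// lerD2r.
  by apply: ler_sum => l _; rewrite exprMn.
rewrite !mulr_sumr; apply: ler_sum => j ji.
exact: sum_excess_le (hk j ji).
Qed.

End Excess.

(** * Largest coefficients and numerical estimates *)

Section Misc.
Variable R : realType.

(** Sorting the absolute values amounts to sorting the indices by absolute value, and [i] is the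
    head of that list. For [K = 1] the second entry is the default 0 of [nth]. *)
Lemma rearr_top2 K (x : 'I_K -> R) : (0 < K)%N ->
  exists i, [/\ `|x i| = c_ x 1, 0 <= c_ x 2 &
    forall j, j != i -> `|x j| <= c_ x 2].
Proof.
move=> K0; rewrite /c_ /rearr sort_map/=.
set t := sort _ _.
have pt : perm_eq t (enum 'I_K) by rewrite perm_sort.
have tot : total (relpre (fun j => `|x j|) (fun a b : R => b <= a)).
  by move=> a b /=; exact: le_total.
have st : sorted (relpre (fun j => `|x j|) (fun a b : R => b <= a)) t.
  exact: sort_sorted.
have mt j : j \in t by rewrite (perm_mem pt) mem_enum.
have ut : uniq t by rewrite (perm_uniq pt) enum_uniq.
clearbody t; case: t => [|i t] in pt st mt ut *; first by have := mt (Ordinal K0).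
exists i; split => //=; first by case: (t) => /=.
move=> j ji; have := mt j; rewrite inE (negbTE ji)/= => {mt pt ut}.
case: t st => [//|k t] /= /andP[_ st]; rewrite inE => /orP[/eqP -> //|jt].
have tr : transitive (relpre (fun j => `|x j|) (fun a b : R => b <= a)).
  by move=> a b e /= h1 h2; exact: le_trans h2 h1.
by move: st; rewrite (path_sortedE tr) => /andP[/allP/(_ _ jt)].
Qed.

(** Supplies the rate hypothesis of [sum_excess_le]. The logarithm in the bound on [eps] produces
    the factor [gamma / (2 * A * k) = expR (- L)], and the rest of the exponent pays for a bound
    linear in [E2]. *)
Lemma excess_rate (eta A k gamma eps E2 : R) :
  1 <= A -> 0 < gamma -> 0 < k -> 1 <= ln (2 * A * k / gamma) ->
  2 * A * ln (2 * A * k / gamma) * eps <= eta ^+ 2 ->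
  eps < 1 / 5 -> 0 <= eps -> 0 < E2 -> E2 <= 2 * eps ^+ 2 ->
  4 * (expR 2 * expR (- (9 * eta ^+ 2 / (4 * A * E2)))) <=
  4 / 5 * (gamma / (2 * A * k)) * E2.
Proof.
move=> A1 g0 k0; set L := ln _ => L1 heta eps1 eps0 E20 E2le.
have A0 : 0 < A by lra.
have e0 : 0 < eps.
  rewrite lt_neqAle eps0 andbT; apply/eqP => h; move: E2le; rewrite -h expr0n/=; lra.
pose z := eps / E2.
have zE : z * E2 = eps by rewrite /z divfK// gt_eqF.
have z0 : 0 < z by rewrite divr_gt0.
have ze : 1 <= 2 * eps * z.
  by rewrite /z mulrA ler_pdivlMr// mul1r; move: E2le; rewrite expr2; lra.
have z2 : 5 / 2 <= z by nra.
have -> : gamma / (2 * A * k) = expR (- L).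
  rewrite expRN /L lnK ?invf_div// posrE divr_gt0// !mulr_gt0//.
(* The right side is at least [9 / 2 * L * z]. As [1 <= L] and [1 <= 2 / 5 * z], one [L] can be
   split off, leaving [(9 / 2 - 2 / 5) * z]. *)
have h1 : L + 41 / 10 * z <= 9 * eta ^+ 2 / (4 * A * E2).
  apply: (@le_trans _ _ (9 / 2 * L * z)); first by nra.
  have -> : 9 / 2 * L * z = 9 * (2 * A * L * eps) / (4 * A * E2).
    by rewrite /z; field; rewrite !gt_eqF.
  by rewrite ler_pM2r ?invr_gt0 ?mulr_gt0// ler_pM2l.
apply: (@le_trans _ _ (4 * (expR 2 * expR (- L + - (41 / 10 * z))))).
  by rewrite ler_pM2l// ler_pM2l ?expR_gt0// ler_expR; lra.
rewrite [expR (- L + _)]expRD.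
suff : 4 * (expR 2 * expR (- (41 / 10 * z))) <= 4 / 5 * E2.
  by move=> H; have := ler_wpM2l (expR_ge0 (- L)) H; lra.
(* The squared factor is of order [z^-2], hence linear in [E2]; the other is at most
   [expR (-4) <= 1 / 16]. Overall [4 * 25 / 8 / 16 = 25 / 32], below [4 / 5]. *)
have -> : expR (2 : R) * expR (- (41 / 10 * z)) =
    expR (- (4 / 5 * z)) ^+ 2 * expR (2 - 5 / 2 * z).
  by rewrite expr2 -!expRD; congr expR; lra.
have e1 : expR (2 - 5 / 2 * z) <= 1 / 16.
  apply: (@le_trans _ _ (expR (-1) ^+ 4)).
    by rewrite -expRM_natl ler_expR; lra.
  have : expR (-1 : R) <= 1 / 2.
    by rewrite expRN -[1 / 2]invrK lef_pV2 ?posrE ?expR_gt0//; have := expR_ge1Dx (1 : R); lra.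
  have := expR_ge0 (-1 : R); move: (expR (-1)) => w w0 w1.
  have w2 : w ^+ 2 <= 1 / 4 by nra.
  by have := sqr_ge0 w; nra.
have e2 : expR (- (4 / 5 * z)) <= (4 / 5 * z)^-1.
  rewrite expRN lef_pV2 ?posrE ?expR_gt0//; last by lra.
  by apply: le_trans (expR_ge1Dx _); lra.
have e3 : expR (- (4 / 5 * z)) ^+ 2 <= 25 / 8 * E2.
  apply: (@le_trans _ _ ((4 / 5 * z)^-1 ^+ 2)).
    by rewrite ler_pXn2r ?nnegrE ?expR_ge0// invr_ge0; lra.
  have -> : (4 / 5 * z)^-1 ^+ 2 = 25 / 16 * (E2 ^+ 2 / eps ^+ 2).
    by rewrite /z; field; rewrite !gt_eqF.
  have : E2 ^+ 2 / eps ^+ 2 <= 2 * E2; last by lra.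
  by rewrite ler_pdivrMr ?exprn_gt0//; nra.
have := expR_ge0 (2 - 5 / 2 * z); have := sqr_ge0 (expR (- (4 / 5 * z))).
move: (expR _ ^+ 2) (expR _) e1 e3 => p q; nra.
Qed.

Lemma ln_ge1 (x : R) : 4 <= x -> 1 <= ln x.
Proof.
move=> x4; rewrite -(@expRK _ 1) ler_ln ?posrE ?expR_gt0//; last by lra.
apply: le_trans x4.
have -> : expR (1 : R) = expR (1 / 2) ^+ 2.
  by rewrite expr2 -expRD; congr expR; lra.
have : expR (1 / 2 : R) <= 2.
  rewrite -[X in expR X]opprK expRN -[leRHS]invrK lef_pV2 ?posrE ?expR_gt0//.
  by apply: le_trans (expR_ge1Dx _); lra.
have := expR_ge0 (1 / 2 : R); nra.
Qed.

(** With [S] the sum of the [e i ^+ 2], the excesses total at most [4 / 5 * gamma * S / A], while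
    the loss is at least [99 / 100 * gamma * S]. *)
Lemma strict_gap K (e : 'I_K -> R) (A gamma C eps : R) :
  (0 < K)%N -> 1 <= A -> 0 < gamma -> 0 <= C -> C <= 1 ->
  (forall i, 0 <= e i) -> (forall i, e i <= eps) -> eps < 1 / 5 ->
  (exists i, 0 < e i) ->
  C * \sum_i \sum_(j | j != i)
    (4 / 5 * (gamma / (2 * A * K%:R))) * (e i ^+ 2 + e j ^+ 2) <
  gamma * \sum_i (1 - (1 - e i ^+ 2 / 2) ^+ 2).
Proof.
move=> K0 A1 g0 C0 C1 e0 ee eps1 [i0 ei0].
have Kp : 0 < K%:R :> R by rewrite ltr0n.
set kap := 4 / 5 * _.
have kap0 : 0 <= kap by rewrite /kap mulr_ge0// divr_ge0 ?mulr_ge0 ?ltW//; lra.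
pose S := \sum_i e i ^+ 2.
have S0 : 0 < S.
  rewrite /S (bigD1 i0)//= ltr_pwDl ?exprn_gt0// sumr_ge0// => j _; exact: sqr_ge0.
have up : \sum_i \sum_(j | j != i) kap * (e i ^+ 2 + e j ^+ 2) <= kap * (2 * K%:R * S).
  apply: (@le_trans _ _ (\sum_i \sum_j kap * (e i ^+ 2 + e j ^+ 2))).
    apply: ler_sum => i _; rewrite [leRHS](bigD1 i)//= lerDr mulr_ge0// addr_ge0 ?sqr_ge0//.
  have E i : \sum_j kap * (e i ^+ 2 + e j ^+ 2) = kap * (K%:R * e i ^+ 2 + S).
    by rewrite -mulr_sumr big_split/= sumr_const card_ord -[_ *+ K]mulr_natl.
  under eq_bigr do rewrite E.
  rewrite -mulr_sumr ler_wpM2l// big_split/= -mulr_sumr -/S sumr_const card_ord.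
  rewrite -[S *+ K]mulr_natl; lra.
(* Each term is [e^2 - e^4 / 4], and [e^2 <= 1 / 25]. *)
have low : 99 / 100 * S <= \sum_i (1 - (1 - e i ^+ 2 / 2) ^+ 2).
  rewrite /S mulr_sumr; apply: ler_sum => i _.
  have h : e i ^+ 2 <= 1 / 25 by have := e0 i; have := ee i; nra.
  by have := sqr_ge0 (e i); nra.
apply: (@le_lt_trans _ _ (1 * (kap * (2 * K%:R * S)))).
  apply: ler_pM => //; apply: sumr_ge0 => i _; apply: sumr_ge0 => j _.
  by rewrite mulr_ge0// addr_ge0 ?sqr_ge0.
have -> : 1 * (kap * (2 * K%:R * S)) = 4 / 5 * gamma * S * A^-1.
  by rewrite /kap; field; rewrite !gt_eqF//; lra.
have Ai : A^-1 <= 1 by rewrite invf_le1//; lra.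
have gS : 0 < gamma * S by rewrite mulr_gt0.
apply: (@lt_le_trans _ _ (gamma * (99 / 100 * S))); last by rewrite ler_pM2l.
have : gamma * S * A^-1 <= gamma * S by rewrite ler_piMr// ltW.
lra.
Qed.

End Misc.

(** * Laws of random vectors *)

Section Law.
Variables (R : realType) (dT : measure_display) (T : measurableType dT).
Variables (P : probability T R) (I : finType).

(* [indep_vec] and [symmetric_law] only speak about boxes, so random vectors are
   viewed as maps into [I -> R] with the sigma-algebra generated by boxes. *)
Definition boxes : set (set (I -> R)) :=
  [set B | exists2 A : I -> set R, (forall i, measurable (A i)) &
    B = [set v | forall i, A i (v i)]].

Definition vecR := g_sigma_algebraType boxes.
HB.instance Definition _ := Measurable.on vecR.

Lemma boxes_measurable B : boxes B -> measurable (B : set vecR).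
Proof. exact: sub_sigma_algebra. Qed.

Lemma measurable_coord i : measurable_fun setT (fun v : vecR => v i : R).
Proof.
move=> _ Y mY; rewrite setTI; apply: boxes_measurable.
exists (fun j => if j == i then Y else setT) => [j|]; first by case: ifP.
apply/seteqP; split => v /= h; last by have := h i; rewrite eqxx.
by move=> j; case: eqP => // ->.
Qed.

Lemma measurable_vec (F : I -> T -> R) :
  (forall i, measurable_fun setT (F i)) ->
  measurable_fun setT (fun w => (fun i => F i w) : vecR).
Proof.
move=> mF; apply: (@measurability _ _ T vecR setT _ boxes) => //.
move=> _ [_ [A mA ->] <-]; rewrite setTI.
have -> : (fun w => (fun i => F i w) : vecR) @^-1` [set v | forall i, A i (v i)] =
    \bigcap_(i in [set: I]) (F i @^-1` A i).
  by apply/seteqP; split => w /= h i; [move=> _|]; apply: h.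
apply: fin_bigcap_measurable => // i _.
by rewrite -[X in measurable X]setTI; exact: mF.
Qed.

Lemma setI_closed_boxes : setI_closed boxes.
Proof.
move=> _ _ [A mA ->] [B mB ->]; exists (fun i => A i `&` B i).
  by move=> i; exact: measurableI.
by apply/seteqP; split => v /= => [[hA hB] i|h]; [split|split => i; have [] := h i].
Qed.

(** The two image measures agree on boxes, a generating pi-system, hence everywhere; the integrals
    are then equal by change of variables. *)
Lemma eq_law_integral (F G : I -> T -> R) (f : vecR -> R) :
  (forall i, measurable_fun setT (F i)) ->
  (forall i, measurable_fun setT (G i)) ->
  (forall A : I -> set R, (forall i, measurable (A i)) ->
    P [set w | forall i, A i (F i w)] = P [set w | forall i, A i (G i w)]) ->
  measurable_fun setT f -> (forall v, 0 <= f v) ->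
  (\int[P]_w (f (fun i => F i w))%:E = \int[P]_w (f (fun i => G i w))%:E)%E.
Proof.
move=> mF mG FG mf f0.
have mfE : measurable_fun setT (EFin \o f) by exact/measurable_EFinP.
pose Z (H : I -> T -> R) (mH : forall i, measurable_fun setT (H i)) :
    {mfun T >-> vecR} :=
  HB.pack (fun w => (fun i => H i w) : vecR)
    (isMeasurableFun.Build _ _ _ _ _ (measurable_vec mH)).
have push H mH : (\int[P]_w (f (fun i => H i w))%:E =
    \int[distribution P (@Z H mH)]_v (f v)%:E)%E.
  by rewrite ge0_integral_distribution.
rewrite (push F mF) (push G mG); apply: eq_measure_integral => A mA _.
set m1 := distribution P (Z F mF); set m2 := distribution P (Z G mG).
apply: (@measure_unique _ R vecR boxes (fun=> setT) _ _ _ _ m1 m2) => //.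
- exact: setI_closed_boxes.
- move=> _; exists (fun=> setT) => //.
  by apply/seteqP; split.
- by rewrite bigcup_const//; exists 0%N.
- by move=> _ [B mB ->]; exact: FG.
- by move=> _; rewrite (le_lt_trans (probability_le1 _ _))// ltry.
Qed.
End Law.

(** * Joint law of coefficients and noise, and its symmetries *)

Section Joint.
Variables (R : realType) (d K : nat).

(** The pair is coded as one vector over the disjoint sum of the index types, so that its joint law
    is again determined by boxes. *)
Definition measurable_xr (f : ('I_K -> R) -> ('I_d -> R) -> R) :=
  measurable_fun [set: vecR R ('I_K + 'I_d)%type]
    (fun v : vecR R ('I_K + 'I_d)%type => f (fun i => v (inl i)) (fun k => v (inr k))).

Definition dominant (i : 'I_K) (x : 'I_K -> R) : bool :=
  [forall j, (j != i) ==> (`|x j| < `|x i|)].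

Lemma dominant_inj x i j : dominant i x -> dominant j x -> i = j.
Proof.
move=> /forallP di /forallP dj; apply/eqP; rewrite -[_ == _]negbK; apply/negP => ij.
have := implyP (dj i) ij; rewrite eq_sym in ij; have := implyP (di j) ij.
by move=> h1 h2; have := lt_trans h1 h2; rewrite ltxx.
Qed.

Lemma dominant_perm (s : 'I_K -> bool) (sigma : {perm 'I_K}) i x :
  dominant i (fun j => (-1) ^+ s j * x (sigma j)) = dominant (sigma i) x.
Proof.
have nE j : `|(-1) ^+ s j * x (sigma j)| = `|x (sigma j)|.
  by rewrite normrM normrX normrN1 expr1n mul1r.
apply/forallP/forallP => h j; apply/implyP => ji.
  have := h (sigma^-1%g j); rewrite !nE permKV => /implyP; apply.
  by apply: contra_neq ji => <-; rewrite permKV.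
by rewrite !nE; apply: (implyP (h (sigma j))); rewrite (inj_eq perm_inj).
Qed.

Lemma sum_dominant x i (F : 'I_K -> R) : dominant i x ->
  \sum_j (dominant j x)%:R * F j = F i.
Proof.
move=> di; rewrite (bigD1 i)//= di mul1r big1 ?addr0// => j ji.
have [dj|] := boolP (dominant j x); last by rewrite mul0r.
by move: ji; rewrite (dominant_inj dj di) eqxx.
Qed.

Lemma measurable_ip_r u : measurable_xr (fun _ r => ip u r).
Proof.
apply: measurable_sum => k; apply: measurable_funM => //; exact: measurable_coord.
Qed.

Lemma measurable_dominant i : measurable_xr (fun x _ => (dominant i x)%:R).
Proof.
have mb : measurable_fun [set: vecR R ('I_K + 'I_d)%type]
    (fun v : vecR R ('I_K + 'I_d)%type => dominant i (fun j => v (inl j))).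
  apply: (measurable_fun_bool true); rewrite setTI.
  have -> : (fun v : vecR R ('I_K + 'I_d)%type => dominant i (fun j => v (inl j))) @^-1` [set true] =
    \bigcap_(j in [set j | j != i]) [set v | `|v (inl j)| < `|v (inl i)|].
    apply/seteqP; split => v /=; first by move=> /forallP h j /= ji; exact: implyP (h j) ji.
    by move=> h; apply/forallP => j; apply/implyP => ji; exact: h.
  apply: fin_bigcap_measurable => [|j _]; first exact: finite_finset.
  rewrite -[X in measurable X]setTI.
  have -> : [set v : vecR R ('I_K + 'I_d)%type | `|v (inl j)| < `|v (inl i)|] =
    (fun v : vecR R ('I_K + 'I_d)%type => `|v (inl j)| < `|v (inl i)|) @^-1` [set true] by [].
  have mn k : measurable_fun setT (fun v : vecR R ('I_K + 'I_d)%type => `|v (inl k)| : R).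
    by apply: measurableT_comp => //; exact: measurable_coord.
  exact: (measurable_fun_ltr (mn j) (mn i)).
by apply: (measurableT_comp (f := fun b : bool => b%:R : R)).
Qed.

Lemma measurable_dom_sqr i l : measurable_xr (fun x _ => (dominant i x)%:R * x l ^+ 2).
Proof.
apply: measurable_funM; first exact: measurable_dominant.
by apply: measurable_funX; exact: measurable_coord.
Qed.

Lemma measurable_dom_noise i u : measurable_xr (fun x r => (dominant i x)%:R * ip u r ^+ 2).
Proof.
apply: measurable_funM; first exact: measurable_dominant.
by apply: measurable_funX; exact: measurable_ip_r.
Qed.

Lemma measurable_bigmax (dT : measure_display) (T : measurableType dT) (I : Type)
    (s : seq I) (F : I -> T -> R) : (forall i, measurable_fun setT (F i)) ->
  measurable_fun setT (fun w => \big[Num.max/0]_(i <- s) F i w).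
Proof.
move=> mF; elim: s => [|i s IH].
  by under eq_fun do rewrite big_nil; exact: measurable_cst.
by under eq_fun do rewrite big_cons; exact: measurable_maxr.
Qed.

Lemma measurable_sup_sq (Psi Phi : 'M[R]_(d, K)) :
  measurable_xr (fun x r => sup_sq Psi (synth Phi x r)).
Proof.
apply: measurable_bigmax => i; apply: measurable_funX.
apply: measurable_sum => k; apply: measurable_funM => //.
apply: measurable_funD; last exact: measurable_coord.
by apply: measurable_sum => l; apply: measurable_funM => //; exact: measurable_coord.
Qed.

Section Integral.
Variables (dT : measure_display) (T : measurableType dT) (P : probability T R).
Variables (X : 'I_K -> T -> R) (Rn : 'I_d -> T -> R).
Hypotheses (mX : forall i, measurable_fun setT (X i))
  (mR : forall k, measurable_fun setT (Rn k)).
Hypotheses (XR : indep_vec P X Rn) (symX : symmetric_law P X).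

Definition joint (F : 'I_K -> T -> R) (G : 'I_d -> T -> R) (k : 'I_K + 'I_d) : T -> R :=
  match k with inl i => F i | inr j => G j end.

Lemma measurable_comp_xr F f : (forall i, measurable_fun setT (F i)) ->
  measurable_xr f -> measurable_fun setT (fun w => f (F^~ w) (Rn^~ w)).
Proof.
move=> mF mf.
have mJ k : measurable_fun setT (joint F Rn k) by case: k => /=.
exact: (measurableT_comp mf (measurable_vec mJ)).
Qed.

Lemma measurable_signed_perm (s : 'I_K -> bool) (sigma : {perm 'I_K}) i :
  measurable_fun setT (fun w => (-1) ^+ s i * X (sigma i) w).
Proof. by apply: measurable_funM => //; exact: mX. Qed.

(** By independence the probability of a joint box factorises, and the symmetry of the law of [X]
    acts on the first factor only. *)
Lemma integral_signed_perm (s : 'I_K -> bool) (sigma : {perm 'I_K}) f :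
  measurable_xr f -> (forall x r, 0 <= f x r) ->
  (\int[P]_w (f (X^~ w) (Rn^~ w))%:E =
   \int[P]_w (f (fun i => (-1) ^+ s i * X (sigma i) w) (Rn^~ w))%:E)%E.
Proof.
move=> mf f0.
pose Y i w := (-1) ^+ s i * X (sigma i) w : R.
have mJ F k : (forall i, measurable_fun setT (F i)) -> measurable_fun setT (joint F Rn k).
  by move=> mF; case: k => /=.
apply: (@eq_law_integral _ _ _ P _ (joint X Rn) (joint Y Rn)
  (fun v => f (fun i => v (inl i)) (fun k => v (inr k)))) => //.
- by move=> k; exact: mJ.
- by move=> k; apply: mJ => i; exact: measurable_signed_perm.
move=> A mA.
have split F : [set w | forall k, A k (joint F Rn k w)] =
    box_event F (A \o inl) `&` box_event Rn (A \o inr).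
  apply/seteqP; split => w /=; first by move=> h; split => k /=; [exact: (h (inl k))|exact: (h (inr k))].
  by move=> [h1 h2] [k|k]; [exact: h1|exact: h2].
(* A box for the signed and permuted vector is pulled back to a box for [X], so that independence
   applies to it. *)
pose A' j := (fun y : R => (-1) ^+ s (sigma^-1%g j) * y) @^-1` A (inl (sigma^-1%g j)).
have YE : box_event Y (A \o inl) = box_event X A'.
  apply/seteqP; split => w h i; last by have := h (sigma i); rewrite /A' /= permK.
  by rewrite /A'/=; have := h (sigma^-1%g i); rewrite /Y /= permKV.
have mA' j : measurable (A' j).
  by rewrite -[X in measurable X]setTI; apply: measurable_funM.
rewrite !split YE !XR//; try by move=> k; exact: mA.
by rewrite -YE; congr (_ * _)%E; apply: symX => k; exact: mA.
Qed.

End Integral.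
End Joint.

(** The common value is finite because an infinite one would make the sum infinite. *)
Lemma equal_share (R : realType) (I : finType) (Q : pred I) (a : I -> \bar R)
    (c : R) i : Q i -> (0 <= a i)%E -> (forall j, Q j -> a j = a i) ->
  (\sum_(j | Q j) a j = c%:E)%E -> a i = (c / #|Q|%:R)%:E.
Proof.
move=> Qi a0 aE; rewrite (eq_bigr (fun=> a i))//.
have Q0 : (0 < #|Q|)%N by apply/card_gt0P; exists i.
case: (a i) a0 => [t||]//= _.
  rewrite sumEFin sumr_const => -[<-]; congr EFin.
  by rewrite -[t *+ _]mulr_natr mulfK// pnatr_eq0 -lt0n.
rewrite (bigD1 i)//= addye//.
by rewrite -ltNye (lt_le_trans (ltNyr 0))// sume_ge0.
Qed.

(** * Moments restricted to the dominance events *)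

Section Moments.
Variables (R : realType) (d K : nat).
Variables (dT : measure_display) (T : measurableType dT) (P : probability T R).
Variables (X : 'I_K -> T -> R) (Rn : 'I_d -> T -> R).
Hypotheses (mX : forall i, measurable_fun setT (X i))
  (mR : forall k, measurable_fun setT (Rn k)).
Hypotheses (XR : indep_vec P X Rn) (symX : symmetric_law P X).
Hypothesis (aedom : {ae P, forall w, exists i, dominant i (X^~ w)}).

Local Notation EE f := (\int[P]_w (f (X^~ w) (Rn^~ w))%:E)%E.

Lemma measurable_EFin_xr f : measurable_xr f ->
  measurable_fun setT (fun w => (f (X^~ w) (Rn^~ w))%:E).
Proof. by move=> mf; apply/measurable_EFinP; exact: measurable_comp_xr. Qed.

Lemma integral_perm (sigma : {perm 'I_K}) f g :
  measurable_xr f -> (forall x r, 0 <= f x r) ->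
  (forall x r, f (fun i => x (sigma i)) r = g x r) -> EE f = EE g.
Proof.
move=> mf f0 fg; rewrite (integral_signed_perm mX mR XR symX (fun=> false) sigma)//.
by apply: eq_integral => w _; rewrite -fg; congr (f _ _)%:E; apply/funext => i; rewrite expr0 mul1r.
Qed.

Lemma dominant_permE (sigma : {perm 'I_K}) i (x : 'I_K -> R) :
  dominant i (fun j => x (sigma j)) = dominant (sigma i) x.
Proof.
rewrite -(dominant_perm (fun=> false)).
by congr (dominant _ _); apply/funext => j; rewrite expr0 mul1r.
Qed.

(* Exchangeability splits an integral evenly among the [K] dominance events. *)
Lemma integral_share (f : 'I_K -> ('I_K -> R) -> ('I_d -> R) -> R)
    (h : ('I_K -> R) -> ('I_d -> R) -> R) (c : R) i :
  (forall j, measurable_xr (f j)) -> measurable_xr h ->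
  (forall j x r, 0 <= f j x r) ->
  (forall j x r, f i (fun l => x (tperm i j l)) r = f j x r) ->
  {ae P, forall w, \sum_j f j (X^~ w) (Rn^~ w) = h (X^~ w) (Rn^~ w)} ->
  EE h = c%:E -> EE (f i) = (c / K%:R)%:E.
Proof.
move=> mf mh f0 fE fh hc.
have := @equal_share R _ predT (fun j => EE (f j)) c i isT; rewrite card_ord; apply.
- by apply: integral_ge0 => w _; rewrite lee_fin.
- by move=> j _; apply/esym; apply: (integral_perm (sigma := tperm i j)) => //.
rewrite -hc -ge0_integral_sum//; last 2 first.
- by move=> j; exact: measurable_EFin_xr.
- by move=> j w _; rewrite lee_fin.
apply: ae_eq_integral => //.
- by apply: emeasurable_sum => j; exact: measurable_EFin_xr.
- exact: measurable_EFin_xr.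
by apply: filterS fh => w h1 _; rewrite sumEFin h1.
Qed.

Lemma dom_sqr_ge0 i l (x : 'I_K -> R) : 0 <= (dominant i x)%:R * x l ^+ 2.
Proof. by rewrite mulr_ge0 ?sqr_ge0. Qed.

Section Coefficients.
Variable c1bar : R.
Hypothesis hmax :
  (\int[P]_w (\big[Num.max/0]_(i < K) (X i w) ^+ 2)%:E)%E = (c1bar ^+ 2)%:E.
Hypothesis aesphere : {ae P, forall w, \sum_i X i w ^+ 2 = 1}.

Lemma bigmax_dominant i (x : 'I_K -> R) : dominant i x ->
  \big[Num.max/0]_j x j ^+ 2 = x i ^+ 2.
Proof.
move=> /forallP di; apply/le_anti; apply/andP; split; last first.
  exact: (@le_bigmax _ _ _ _ (fun j => x j ^+ 2)).
apply: bigmax_le => [|j _]; first exact: sqr_ge0.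
have [->//|ji] := eqVneq j i.
rewrite -(real_normK (num_real (x j))) -(real_normK (num_real (x i))).
by rewrite ler_pXn2r ?nnegrE// ltW// (implyP (di j)).
Qed.

Lemma integral_dom_sqr i :
  EE (fun x _ => (dominant i x)%:R * x i ^+ 2) = (c1bar ^+ 2 / K%:R)%:E.
Proof.
apply: (integral_share (f := fun i x _ => (dominant i x)%:R * x i ^+ 2)
  (h := fun x _ => \big[Num.max/0]_(i < K) x i ^+ 2)) => //.
- by move=> j; exact: measurable_dom_sqr.
- by apply: measurable_bigmax => j; apply: measurable_funX; exact: measurable_coord.
- by move=> j x _; exact: dom_sqr_ge0.
- by move=> j x _; rewrite dominant_permE tpermL.
apply: filterS aedom => w [j dj].
by rewrite (sum_dominant (fun j => X j w ^+ 2) dj) (bigmax_dominant dj).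
Qed.

Lemma integral_dom i : EE (fun x _ => (dominant i x)%:R) = (1 / K%:R)%:E.
Proof.
apply: (integral_share (f := fun i x _ => (dominant i x)%:R) (h := fun _ _ => 1)) => //.
- by move=> j; exact: measurable_dominant.
- exact: measurable_cst.
- by move=> j x _; rewrite dominant_permE tpermL.
- apply: filterS aedom => w [j dj].
  by have := sum_dominant (fun=> 1) dj; under eq_bigr do rewrite mulr1.
- by rewrite integral_cst//= mul1e probability_setT.
Qed.

(** On the sphere the moments over all [l] add up to [1 / K]. Removing the one at [i] leaves [K - 1]
    terms, equal by exchangeability. *)
Lemma integral_dom_sqr_off i l : l != i ->
  EE (fun x _ => (dominant i x)%:R * x l ^+ 2) =
  ((1 - c1bar ^+ 2) / (K%:R * (K%:R - 1)))%:E.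
Proof.
move=> li.
pose a l := EE (fun x _ => (dominant i x)%:R * x l ^+ 2).
have sa : (\sum_l a l = (1 / K%:R)%:E)%E.
  rewrite -(integral_dom i) /a -ge0_integral_sum//; last 2 first.
  - by move=> j; exact: (measurable_EFin_xr (@measurable_dom_sqr _ _ _ i j)).
  - by move=> j w _; rewrite lee_fin dom_sqr_ge0.
  apply: ae_eq_integral => //.
  - by apply: emeasurable_sum => j; exact: (measurable_EFin_xr (@measurable_dom_sqr _ _ _ i j)).
  - by exact: (measurable_EFin_xr (@measurable_dominant _ _ _ i)).
  by apply: filterS aesphere => w h _; rewrite sumEFin -mulr_sumr h mulr1.
have -> : ((1 - c1bar ^+ 2) / (K%:R * (K%:R - 1)))%:E =
    ((1 / K%:R - c1bar ^+ 2 / K%:R) / #|[pred j | j != i]|%:R)%:E :> \bar R.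
  have -> : #|[pred j | j != i]| = K.-1 by rewrite cardC1 card_ord.
  have K0 : (0 < K)%N by exact: leq_ltn_trans (ltn_ord i).
  by rewrite -[in RHS](prednK K0) -[in LHS](prednK K0) -natr1 addrK -mulrBl invfM mulrA.
apply: (equal_share (a := a)) => //=.
- by apply: integral_ge0 => w _; rewrite lee_fin dom_sqr_ge0.
(* This transposition fixes [i], hence preserves the event that [i] is dominant. *)
- move=> j ji; apply/esym; apply: (integral_perm (sigma := tperm l j)).
  + exact: measurable_dom_sqr.
  + by move=> x _; exact: dom_sqr_ge0.
  + by move=> x _; rewrite dominant_permE tpermL tpermD.
move: sa; rewrite (bigD1 i)//= {1}/a integral_dom_sqr.
by case: (\sum_(_ | _) _)%E => [t|//|//] /=; rewrite -EFinD => -[<-]; congr EFin; ring.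
Qed.

End Coefficients.

Section Noise.
Variable rho : R.
Hypothesis covR : forall k l,
  (\int[P]_w (Rn k w * Rn l w)%:E)%E = (if k == l then rho ^+ 2 else 0)%:E.

(** [|r_k r_l|] is dominated by [r_k^2 + r_l^2], whose integral is finite by the diagonal
    covariances. *)
Lemma integrable_noise k l : P.-integrable setT (fun w => (Rn k w * Rn l w)%:E).
Proof.
have sq k' : P.-integrable setT (fun w => (Rn k' w * Rn k' w)%:E).
  apply/integrableP; split; first by apply/measurable_EFinP; exact: measurable_funM.
  rewrite (eq_integral (fun w => (Rn k' w * Rn k' w)%:E)); first by rewrite covR ltry.
  by move=> w _; rewrite gee0_abs// lee_fin -expr2 sqr_ge0.
have := integrableD measurableT (sq k) (sq l).
apply: le_integrable => //; first by apply/measurable_EFinP; exact: measurable_funM.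
move=> w _; rewrite -EFinD !abse_EFin lee_fin.
rewrite [leRHS]ger0_norm; last by rewrite addr_ge0// -expr2 sqr_ge0.
rewrite normrM -[Rn k w * Rn k w]expr2 -[Rn l w * Rn l w]expr2.
rewrite -(real_normK (num_real (Rn k w))) -(real_normK (num_real (Rn l w))).
have := normr_ge0 (Rn k w); have := normr_ge0 (Rn l w).
move: (`|Rn k w|) (`|Rn l w|) => p q p0 q0.
have := sqr_ge0 (p - q); nra.
Qed.

Lemma integral_ip_noise u : ip u u = 1 ->
  (\int[P]_w (ip u (Rn^~ w) ^+ 2)%:E)%E = (rho ^+ 2)%:E.
Proof.
move=> u1.
have E w : (ip u (Rn^~ w) ^+ 2)%:E =
    (\sum_k \sum_l (u k * u l)%:E * (Rn k w * Rn l w)%:E)%E.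
  rewrite expr2 /ip mulr_suml -sumEFin; apply: eq_bigr => k _.
  rewrite mulr_sumr -sumEFin; apply: eq_bigr => l _.
  by rewrite -EFinM; congr EFin; ring.
have ikl k l : P.-integrable setT (fun w => ((u k * u l)%:E * (Rn k w * Rn l w)%:E)%E).
  by apply: integrableZl => //; exact: integrable_noise.
under eq_integral do rewrite E.
rewrite integral_sum//; last by move=> k; exact: integrable_sum.
rewrite (eq_bigr (fun k => (u k * u k * rho ^+ 2)%:E)); last first.
  move=> k _; rewrite integral_sum//.
  rewrite (bigD1 k)//= big1 ?adde0; last first.
    move=> l lk; rewrite integralZl//; last exact: integrable_noise.
    by rewrite covR eq_sym (negbTE lk) mule0.
  rewrite integralZl//; last exact: integrable_noise.
  by rewrite covR eqxx.
by rewrite sumEFin -mulr_suml -/(ip u u) u1 mul1r.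
Qed.

Lemma integral_dom_noise i u : ip u u = 1 ->
  EE (fun x r => (dominant i x)%:R * ip u r ^+ 2) = (rho ^+ 2 / K%:R)%:E.
Proof.
move=> u1.
apply: (integral_share (f := fun i x r => (dominant i x)%:R * ip u r ^+ 2)
  (h := fun _ r => ip u r ^+ 2)) => //.
- by move=> j; exact: measurable_dom_noise.
- by apply: measurable_funX; exact: measurable_ip_r.
- by move=> j x r; rewrite mulr_ge0 ?sqr_ge0.
- by move=> j x r; rewrite dominant_permE tpermL.
- by apply: filterS aedom => w [j dj]; rewrite (sum_dominant (fun=> ip u (Rn^~ w) ^+ 2) dj).
- exact: integral_ip_noise.
Qed.

End Noise.
End Moments.

(** * The objective *)

Section Objective.
Variables (R : realType) (d K : nat) (Phi : 'M[R]_(d, K)) (A : R).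
Hypothesis frame : unit_norm_tight_frame Phi A.
Variables (dT : measure_display) (T : measurableType dT) (P : probability T R).
Variables (X : 'I_K -> T -> R) (Rn : 'I_d -> T -> R).
Hypotheses (mX : forall i, measurable_fun setT (X i))
  (mR : forall k, measurable_fun setT (Rn k)).
Hypotheses (XR : indep_vec P X Rn) (symX : symmetric_law P X).
Hypothesis (aedom : {ae P, forall w, exists i, dominant i (X^~ w)}).
Variables (c1bar rho : R).
Hypothesis hmax :
  (\int[P]_w (\big[Num.max/0]_(i < K) (X i w) ^+ 2)%:E)%E = (c1bar ^+ 2)%:E.
Hypothesis aesphere : {ae P, forall w, \sum_i X i w ^+ 2 = 1}.
Hypothesis covR : forall k l,
  (\int[P]_w (Rn k w * Rn l w)%:E)%E = (if k == l then rho ^+ 2 else 0)%:E.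

Local Notation EE f := (\int[P]_w (f (X^~ w) (Rn^~ w))%:E)%E.

Lemma integral_sign_average f :
  measurable_xr f -> (forall x r, 0 <= f x r) ->
  ((2 ^+ K)%:E * EE f = \int[P]_w (\sum_s f (signed (X^~ w) s) (Rn^~ w))%:E)%E.
Proof.
move=> mf f0; under [RHS]eq_integral do rewrite -sumEFin.
have sE s : EE f = (\int[P]_w (f (signed (X^~ w) s) (Rn^~ w))%:E)%E.
  rewrite (integral_signed_perm mX mR XR symX s 1%g)//.
  apply: eq_integral => w _; congr (f _ _)%:E; apply/funext => i.
  by rewrite perm1.
rewrite ge0_integral_sum//.
- rewrite (eq_bigr (fun=> EE f)) => [|s _]; last by rewrite -sE.
  have card : #|{: {ffun 'I_K -> bool}}| = (2 ^ K)%N.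
    by rewrite card_ffun card_bool card_ord.
  by rewrite sumr_const card -natrX mule_natl.
- move=> s; apply/measurable_EFinP.
  apply: (@measurable_comp_xr _ _ _ _ _ Rn mR (fun i w => sgn R s i * X i w) f) => // i.
  exact: measurable_funM.
- by move=> s w _; rewrite lee_fin.
Qed.

Section Bound.
Variables (Psi : 'M[R]_(d, K)) (del : 'I_K -> R).

(* Sign average of [sup_sq Psi], up to the error [del i * x i ^+ 2] when atom [i]
   is dominant. *)
Definition dominant_bound (x : 'I_K -> R) (r : 'I_d -> R) : R :=
  \sum_i (\sum_l atom_ip Phi l (Psi^~ i) ^+ 2 * ((dominant i x)%:R * x l ^+ 2)
    + (dominant i x)%:R * ip (Psi^~ i) r ^+ 2
    + del i * ((dominant i x)%:R * x i ^+ 2)).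

Lemma dominant_boundE x r i : dominant i x ->
  dominant_bound x r =
  \sum_l x l ^+ 2 * atom_ip Phi l (Psi^~ i) ^+ 2 + ip (Psi^~ i) r ^+ 2
  + x i ^+ 2 * del i.
Proof.
move=> di; rewrite -(sum_dominant (fun i => \sum_l x l ^+ 2 * atom_ip Phi l (Psi^~ i) ^+ 2
  + ip (Psi^~ i) r ^+ 2 + x i ^+ 2 * del i) di).
apply: eq_bigr => j _; rewrite !mulrDr mulr_sumr; congr (_ + _ + _); last by ring.
by apply: eq_bigr => l _; ring.
Qed.

Lemma measurable_dominant_bound : measurable_xr dominant_bound.
Proof.
apply: measurable_sum => i; apply: measurable_funD; first apply: measurable_funD.
- by apply: measurable_sum => l; apply: measurable_funM => //; exact: measurable_dom_sqr.
- exact: measurable_dom_noise.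
- by apply: measurable_funM => //; exact: measurable_dom_sqr.
Qed.

Hypotheses (dictPsi : is_dict Psi) (del0 : forall i, 0 <= del i).

Lemma dominant_bound_ge0 x r : 0 <= dominant_bound x r.
Proof.
apply: sumr_ge0 => i _; rewrite !addr_ge0//.
- by apply: sumr_ge0 => l _; rewrite mulr_ge0 ?sqr_ge0// mulr_ge0 ?sqr_ge0.
- by rewrite mulr_ge0 ?sqr_ge0.
- by rewrite mulr_ge0// mulr_ge0 ?sqr_ge0.
Qed.

Local Notation off := ((1 - c1bar ^+ 2) / (K%:R - 1)).

(** [off / K] is the mean of [x l ^+ 2] for a fixed non-dominant [l] on a fixed dominance event, so
    the coefficient [c1bar ^+ 2 - off] is the [gamma] of the final estimate. *)
Lemma integral_dominant_bound :
  EE dominant_bound = (\sum_i ((A * off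
     + atom_ip Phi i (Psi^~ i) ^+ 2 * (c1bar ^+ 2 - off) + rho ^+ 2
     + c1bar ^+ 2 * del i) / K%:R))%:E.
Proof.
have ms i l : measurable_fun setT (fun w => ((dominant i (X^~ w))%:R * X l w ^+ 2)%:E).
  exact: (measurable_EFin_xr mX mR (@measurable_dom_sqr R d K i l)).
have ms0 i l w : (0 <= ((dominant i (X^~ w))%:R * X l w ^+ 2)%:E)%E.
  by rewrite lee_fin mulr_ge0 ?sqr_ge0.
have mn i : measurable_fun setT
    (fun w => ((dominant i (X^~ w))%:R * ip (Psi^~ i) (Rn^~ w) ^+ 2)%:E).
  exact: (measurable_EFin_xr mX mR (@measurable_dom_noise R d K i _)).
have mn0 i w : (0 <= ((dominant i (X^~ w))%:R * ip (Psi^~ i) (Rn^~ w) ^+ 2)%:E)%E.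
  by rewrite lee_fin mulr_ge0 ?sqr_ge0.
pose a i l := atom_ip Phi l (Psi^~ i) ^+ 2.
have a0 i l : 0 <= a i l by exact: sqr_ge0.
have mas i l : measurable_fun setT (fun w =>
    ((a i l)%:E * ((dominant i (X^~ w))%:R * X l w ^+ 2)%:E)%E).
  by apply: measurable_funeM.
have mds i : measurable_fun setT (fun w =>
    ((del i)%:E * ((dominant i (X^~ w))%:R * X i w ^+ 2)%:E)%E).
  by apply: measurable_funeM.
have mS i : measurable_fun setT (fun w =>
    (\sum_l (a i l)%:E * ((dominant i (X^~ w))%:R * X l w ^+ 2)%:E)%E).
  by apply: emeasurable_sum => l.
have S0 i w : (0 <= \sum_l (a i l)%:E * ((dominant i (X^~ w))%:R * X l w ^+ 2)%:E)%E.
  by apply: sume_ge0 => l _; rewrite mule_ge0// lee_fin.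
have E w : (dominant_bound (X^~ w) (Rn^~ w))%:E =
    (\sum_i (\sum_l (a i l)%:E * ((dominant i (X^~ w))%:R * X l w ^+ 2)%:E
      + ((dominant i (X^~ w))%:R * ip (Psi^~ i) (Rn^~ w) ^+ 2)%:E
      + (del i)%:E * ((dominant i (X^~ w))%:R * X i w ^+ 2)%:E))%E.
  rewrite -sumEFin; apply: eq_bigr => i _; rewrite 2!EFinD -sumEFin.
  by congr (_ + _ + _)%E.
under eq_integral do rewrite E.
rewrite ge0_integral_sum//; last 2 first.
- by move=> i; apply: emeasurable_funD => //; exact: emeasurable_funD.
- by move=> i w _; rewrite !adde_ge0// ?mule_ge0// ?lee_fin.
rewrite -sumEFin; apply: eq_bigr => i _.
rewrite ge0_integralD//;
  [|by move=> w _; rewrite adde_ge0|exact: emeasurable_funD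
   |by move=> w _; rewrite mule_ge0// lee_fin].
rewrite ge0_integralD// ge0_integral_sum//; last by move=> l w _; rewrite mule_ge0// lee_fin.
rewrite (integral_dom_noise mX mR XR symX aedom covR)//; last exact: dict_ip1.
rewrite ge0_integralZl_EFin// (integral_dom_sqr mX mR XR symX aedom hmax).
(* Giving every [l] the off-diagonal moment and correcting at [l = i] lets the frame identity sum
   all the [a i l] to [A]. *)
rewrite (eq_bigr (fun l => (a i l * (off / K%:R) +
    (if l == i then a i i * (c1bar ^+ 2 - off) / K%:R else 0))%:E)); last first.
  move=> l _; rewrite ge0_integralZl_EFin//; have [->|li] := eqVneq l i.
    by rewrite (integral_dom_sqr mX mR XR symX aedom hmax) -EFinM; congr EFin; ring.
  rewrite (integral_dom_sqr_off mX mR XR symX aedom hmax aesphere li) -EFinM; congr EFin.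
  by rewrite invfM; ring.
rewrite sumEFin -!EFinM -!EFinD; congr EFin.
rewrite big_split/= -mulr_suml -big_mkcond/= big_pred1_eq.
have -> : \sum_l a i l = A by have [_ ->] := frame; rewrite dictPsi expr1n mulr1.
rewrite /a; ring.
Qed.

Lemma measurable_sign_sum : measurable_fun setT (fun w =>
  (\sum_s sup_sq Psi (synth Phi (signed (X^~ w) s) (Rn^~ w)))%:E).
Proof.
apply/measurable_EFinP; apply: measurable_sum => s.
apply: (@measurable_comp_xr _ _ _ _ _ Rn mR (fun i w => sgn R s i * X i w) _ _
  (measurable_sup_sq Psi Phi)) => i.
exact: measurable_funM.
Qed.

Lemma objective_le :
  {ae P, forall w, \sum_s sup_sq Psi (synth Phi (signed (X^~ w) s) (Rn^~ w)) <=
    2 ^+ K * dominant_bound (X^~ w) (Rn^~ w)} ->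
  (objective P Psi Phi X Rn <= EE dominant_bound)%E.
Proof.
move=> ub.
have p0 : (0 < (2 ^+ K)%:E :> \bar R)%E by rewrite lte_fin exprn_gt0.
rewrite -(lee_pmul2l _ p0)//.
have sup0 x r : 0 <= sup_sq Psi (synth Phi x r) by exact: bigmax_ge_id.
have -> : objective P Psi Phi X Rn = EE (fun x r => sup_sq Psi (synth Phi x r)) by [].
rewrite (integral_sign_average (measurable_sup_sq Psi Phi) sup0).
have mb := measurable_EFin_xr mX mR measurable_dominant_bound.
rewrite -ge0_integralZl_EFin ?exprn_ge0//; last first.
  by move=> w _; rewrite lee_fin dominant_bound_ge0.
apply: ae_ge0_le_integral => //.
- by move=> w _; rewrite lee_fin sumr_ge0.
- exact: measurable_sign_sum.
- by move=> w _; rewrite mule_ge0// lee_fin ?exprn_ge0// dominant_bound_ge0.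
- exact: measurable_funeM.
- by apply: filterS ub => w h _; rewrite -EFinM lee_fin.
Qed.

(** The maximum is at least the square at the dominant atom, whose sign average is exactly the bound
    without error term. *)
Lemma objective_ge : (forall i, del i = 0) ->
  (EE dominant_bound <= objective P Psi Phi X Rn)%E.
Proof.
move=> delz.
have p0 : (0 < (2 ^+ K)%:E :> \bar R)%E by rewrite lte_fin exprn_gt0.
rewrite -(lee_pmul2l _ p0)//.
have sup0 x r : 0 <= sup_sq Psi (synth Phi x r) by exact: bigmax_ge_id.
have -> : objective P Psi Phi X Rn = EE (fun x r => sup_sq Psi (synth Phi x r)) by [].
rewrite (integral_sign_average (measurable_sup_sq Psi Phi) sup0).
have mb := measurable_EFin_xr mX mR measurable_dominant_bound.
rewrite -ge0_integralZl_EFin ?exprn_ge0//; last first.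
  by move=> w _; rewrite lee_fin dominant_bound_ge0.
apply: ae_ge0_le_integral => //.
- by move=> w _; rewrite mule_ge0// lee_fin ?exprn_ge0// dominant_bound_ge0.
- exact: measurable_funeM.
- by move=> w _; rewrite lee_fin sumr_ge0.
- exact: measurable_sign_sum.
apply: filterS aedom => w [i di] _; rewrite -EFinM lee_fin (dominant_boundE _ di).
rewrite delz mulr0 addr0.
under eq_bigr do rewrite -exprMn.
rewrite -sum_sqr_rademacher; apply: ler_sum => s _.
have -> : \sum_l sgn R s l * (X l w * atom_ip Phi l (Psi^~ i)) + ip (Psi^~ i) (Rn^~ w) =
    atom_ip Psi i (synth Phi (signed (X^~ w) s) (Rn^~ w)).
  rewrite -[RHS]/(ip (Psi^~ i) _) ip_synth; congr (_ + _).
  by apply: eq_bigr => l _; rewrite mulrA.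
exact: (@le_bigmax _ _ _ _ (fun j => atom_ip Psi j _ ^+ 2)).
Qed.

End Bound.
End Objective.

(** * Distance between dictionaries and the one-atom case *)

Section DictDist.
Variables (R : realType) (d K : nat).
Implicit Types Phi Psi : 'M[R]_(d, K).

Lemma le_dict_dist Psi Phi i : l2norm (atom_diff Psi Phi i) <= dict_dist Psi Phi.
Proof. exact: (@le_bigmax _ _ _ _ (fun i => l2norm (atom_diff Psi Phi i))). Qed.

Lemma dict_dist_gt0 Psi Phi : 0 < dict_dist Psi Phi ->
  exists i, 0 < l2norm (atom_diff Psi Phi i).
Proof.
move=> h; apply: contrapT => /forallNP n0; move: h; rewrite ltNge => /negP; apply.
by apply: bigmax_le => // i _; rewrite leNgt; apply/negP; exact: n0.
Qed.

Lemma dict_dist_le0 Psi Phi : dict_dist Psi Phi <= 0 -> Psi = Phi.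
Proof.
move=> h; apply/matrixP => k i; apply/eqP; rewrite -subr_eq0 -sqrf_eq0.
have : ip (atom_diff Psi Phi i) (atom_diff Psi Phi i) = 0.
  rewrite -l2norm_sqr; apply/eqP; rewrite sqrf_eq0 eq_le l2norm_ge0 andbT.
  exact: le_trans (le_dict_dist _ _ _) h.
move=> /eqP; rewrite psumr_eq0; last by move=> j _; rewrite -expr2 sqr_ge0.
by move=> /allP/(_ k); rewrite mem_index_enum /atom_diff -expr2 => /(_ isT).
Qed.

(** The frame identity at an atom contains the term 1 of that atom itself. *)
Lemma frame_constant_ge1 Phi A (i : 'I_K) : unit_norm_tight_frame Phi A -> 1 <= A.
Proof.
move=> [hPhi hA]; have := hA (Phi^~ i); rewrite hPhi expr1n mulr1 => <-.
rewrite (bigD1 i)//=.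
have -> : atom_ip Phi i (Phi^~ i) = 1 by exact: dict_ip1.
by rewrite expr1n lerDl sumr_ge0// => j _; rewrite sqr_ge0.
Qed.

(** The frame identity forces [A = 1] and then [<phi, psi>^2 = 1]. The solution [psi = - phi] is too
    far away. *)
Lemma single_atom_rigid Psi Phi A : K = 1%N -> unit_norm_tight_frame Phi A ->
  is_dict Psi -> dict_dist Psi Phi < 1 / 5 -> dict_dist Psi Phi <= 0.
Proof.
move=> K1 frame hPsi dist; have [hPhi hA] := frame.
have i0 (i : 'I_K) (F : 'I_K -> R) : \sum_j F j = F i.
  rewrite (bigD1 i)//= big1 ?addr0// => j /eqP[]; apply/val_inj.
  have := leq_trans (ltn_ord i) (eq_leq K1); have := leq_trans (ltn_ord j) (eq_leq K1).
  by rewrite !ltnS !leqn0 /= => /eqP -> /eqP ->.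
apply: bigmax_le => // i _; rewrite -/(atom_diff Psi Phi i).
have A1 : A = 1.
  have := hA (Phi^~ i); rewrite hPhi expr1n mulr1 (i0 i) => <-.
  have -> : atom_ip Phi i (Phi^~ i) = 1 by exact: dict_ip1.
  by rewrite expr1n.
have := hA (Psi^~ i); rewrite hPsi A1 expr1n mulr1 (i0 i) atom_ip_diff//.
have := le_lt_trans (le_dict_dist Psi Phi i) dist.
have := l2norm_ge0 (atom_diff Psi Phi i); move: (l2norm _) => e e0 e1 h.
have e2 : e ^+ 2 <= 1 / 25 by nra.
have : e ^+ 2 = 0 by have := sqr_ge0 e; nra.
by move=> /eqP; rewrite sqrf_eq0 => /eqP ->.
Qed.

End DictDist.

(** * Consequences of separation and the strict inequality *)

Section Main.
Variables (R : realType) (dT : measure_display) (T : measurableType dT)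
  (P : probability T R) (d K : nat) (Phi : 'M[R]_(d, K)) (A : R)
  (X : 'I_K -> T -> R) (Rn : 'I_d -> T -> R)
  (rho rho_max c1bar beta : R).
Hypothesis frame : unit_norm_tight_frame Phi A.
Hypotheses (mX : forall i, measurable_fun setT (X i))
  (mR : forall k, measurable_fun setT (Rn k)).
Hypotheses (XR : indep_vec P X Rn) (symX : symmetric_law P X).
Hypothesis noise_le : {ae P, forall w, l2norm (Rn^~ w) <= rho_max}.
Hypothesis covR : forall k l,
  (\int[P]_w (Rn k w * Rn l w)%:E)%E = (if k == l then rho ^+ 2 else 0)%:E.
Hypothesis sphere : {ae P, forall w, l2norm (X^~ w) = 1}.
Hypothesis hmax :
  (\int[P]_w (\big[Num.max/0]_(i < K) (X i w) ^+ 2)%:E)%E = (c1bar ^+ 2)%:E.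
Hypothesis beta_lt : beta < 1 / 2.
Hypothesis sep : {ae P, forall w, let x := fun i => X i w in
     0 < c_ x 1 - c_ x 2 /\
     (c_ x 2 + coherence Phi * c_l1 x + rho_max) / (c_ x 1 - c_ x 2) <= beta}.

Definition separated_at (i : 'I_K) (c c2 : R) (x : 'I_K -> R) :=
  [/\ `|x i| = c, 0 <= c2, c2 < c, forall l, l != i -> `|x l| <= c2 &
    c2 + coherence Phi * c_l1 x + rho_max <= beta * (c - c2)].

Lemma ae_ex (Q : T -> Prop) : {ae P, forall w, Q w} -> exists w, Q w.
Proof.
have muT : (0 < P [set: T])%E by rewrite probability_setT lte01.
have pf := ae_properfilter_algebraOfSetsType muT.
exact: filter_ex.
Qed.

Lemma sphere_dim_gt0 : (0 < K)%N.
Proof.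
have [w h] := ae_ex sphere; have [K0|//] := posnP K.
move: h; rewrite /l2norm big1; last first.
  by move=> i _; have := leq_trans (ltn_ord i) (eq_leq K0).
by rewrite sqrtr0 => /esym/eqP; rewrite oner_eq0.
Qed.

Lemma separated_ae : {ae P, forall w, exists i c c2, separated_at i c c2 (X^~ w)}.
Proof.
apply: filterS sep => w /= [c12 h].
have [i [xi c20 xl]] := rearr_top2 (X^~ w) sphere_dim_gt0.
exists i, (c_ (X^~ w) 1), (c_ (X^~ w) 2); split => //; first by rewrite -subr_gt0.
by rewrite -ler_pdivrMr.
Qed.

Lemma separated_dominant i c c2 x : separated_at i c c2 x -> dominant i x.
Proof.
move=> [xi c20 c2c xl _]; apply/forallP => j; apply/implyP => ji.
by rewrite xi; exact: le_lt_trans (xl j ji) c2c.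
Qed.

Lemma dominant_ae : {ae P, forall w, exists i, dominant i (X^~ w)}.
Proof.
by apply: filterS separated_ae => w [i [c [c2 /separated_dominant h]]]; exists i.
Qed.

Lemma sphere_sum : {ae P, forall w, \sum_i X i w ^+ 2 = 1}.
Proof.
apply: filterS sphere => w h; have := l2norm_sqr (X^~ w).
by rewrite h expr1n => ->; apply: eq_bigr => i _; rewrite expr2.
Qed.

Lemma rho_max_ge0 : 0 <= rho_max.
Proof. by have [w] := ae_ex noise_le; apply: le_trans; exact: l2norm_ge0. Qed.

(** The numerator of the separation ratio is nonnegative and its denominator positive. *)
Lemma separated_beta_ge0 i c c2 x : separated_at i c c2 x -> 0 <= beta.
Proof.
move=> [xi c20 c2c xl h].
have m0 : 0 <= coherence Phi * c_l1 x by rewrite mulr_ge0 ?coherence_ge0 ?sumr_ge0.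
rewrite -(pmulr_lge0 beta (_ : 0 < c - c2)) ?subr_gt0//.
by apply: le_trans h; rewrite !addr_ge0// rho_max_ge0.
Qed.

Lemma beta_ge0 : 0 <= beta.
Proof. by have [w [i [c [c2 /separated_beta_ge0]]]] := ae_ex separated_ae. Qed.

Lemma separated_c2_le i c c2 x : separated_at i c c2 x -> c2 <= 1 / 2 * c.
Proof.
move=> [xi c20 c2c xl h].
have m0 : 0 <= coherence Phi * c_l1 x by rewrite mulr_ge0 ?coherence_ge0 ?sumr_ge0.
have bc : beta * (c - c2) <= 1 / 2 * (c - c2).
  by rewrite ler_wpM2r ?subr_ge0 ?(ltW c2c)// ltW.
have := rho_max_ge0; lra.
Qed.

Let mmax : measurable_fun setT (fun w => (\big[Num.max/0]_(i < K) (X i w) ^+ 2)%:E).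
Proof. by apply/measurable_EFinP; apply: measurable_bigmax => i; exact: measurable_funX. Qed.

Let max0 w : (0 <= (\big[Num.max/0]_(i < K) (X i w) ^+ 2)%:E)%E.
Proof. by rewrite lee_fin bigmax_ge_id. Qed.

Lemma c1bar_sqr_le1 : c1bar ^+ 2 <= 1.
Proof.
rewrite -lee_fin -hmax -(mul1e 1%E) -{2}(probability_setT P) -(integral_cst P measurableT 1).
apply: ae_ge0_le_integral => //.
apply: filterS2 sphere_sum dominant_ae => w h [i di] _.
rewrite lee_fin (bigmax_dominant di) -h (bigD1 i)//= lerDl sumr_ge0// => j _.
exact: sqr_ge0.
Qed.

(* The top coefficient is at least twice every other one, so it carries more than
   its average share [1 / K] of the energy. *)
Lemma c1bar_sqr_ge : 1 <= (1 + (K%:R - 1) / 4) * c1bar ^+ 2.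
Proof.
have K1 : 1 <= K%:R :> R by rewrite ler1n sphere_dim_gt0.
have k0 : 0 <= 1 + (K%:R - 1) / 4 :> R by lra.
rewrite -lee_fin EFinM -hmax -ge0_integralZl_EFin//.
apply: (@le_trans _ _ (\int[P]_w 1)%E).
  by rewrite integral_cst//= mul1e probability_setT.
apply: ae_ge0_le_integral => //.
- by move=> w _; rewrite mule_ge0// lee_fin.
- exact: measurable_funeM.
apply: filterS2 sphere_sum separated_ae => w h [i [c [c2 s]]] _.
have [xi c20 c2c xl _] := s; have c2le := separated_c2_le s.
rewrite -EFinM lee_fin (bigmax_dominant (separated_dominant s)) -[leLHS]h.
rewrite (bigD1 i)//= mulrDl mul1r lerD2l.
have xE : X i w ^+ 2 = c ^+ 2 by rewrite -xi real_normK ?num_real.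
apply: (@le_trans _ _ (\sum_(j | j != i) c ^+ 2 / 4)).
  apply: ler_sum => j ji; rewrite -(real_normK (num_real (X j w))).
  have := xl j ji; have := normr_ge0 (X j w); move: `|_| => t t0 tc; nra.
have Ke : K.-1%:R = K%:R - 1 :> R by rewrite -[in RHS](prednK sphere_dim_gt0) -natr1 addrK.
by rewrite sumr_const cardC1 card_ord xE -[_ *+ _]mulr_natr Ke; lra.
Qed.

(** [gamma] equals [(K * c1bar^2 - 1) / (K - 1)], positive by [c1bar_sqr_ge] since
    [1 + (K - 1) / 4 < K]. The logarithm is at least 1 because its argument is at least 4. *)
Lemma gap_bounds : (1 < K)%N ->
  let gamma := c1bar ^+ 2 - (1 - c1bar ^+ 2) / (K%:R - 1) in
  [/\ 0 < gamma, gamma <= 1 & 1 <= ln (2 * A * K%:R / gamma)].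
Proof.
move=> K1 gamma.
have n2 : 2 <= K%:R :> R by rewrite ler_nat.
have C1 := c1bar_sqr_le1; have C4 := c1bar_sqr_ge.
have g0 : 0 < gamma.
  have -> : gamma = (K%:R * c1bar ^+ 2 - 1) / (K%:R - 1).
    by rewrite /gamma; field; rewrite gt_eqF//; lra.
  rewrite divr_gt0//; last by lra.
  by rewrite subr_gt0; move: (c1bar ^+ 2) C1 C4 (sqr_ge0 c1bar) => C; nra.
have g1 : gamma <= 1.
  rewrite /gamma lerBlDr (le_trans C1)// lerDl divr_ge0//; lra.
split => //; apply: ln_ge1; rewrite ler_pdivlMr//.
have A1 := frame_constant_ge1 (Ordinal (ltnW K1)) frame.
nra.
Qed.

(** The upper bound for [Psi] with error [del] and the lower bound for [Phi] with error 0 are both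
    integrated explicitly, then compared by [strict_gap]. *)
Lemma strict_local_max eps Psi : (1 < K)%N -> is_dict Psi -> eps < 1 / 5 ->
  eps <= (1 - 2 * beta) ^+ 2 / (2 * A * ln (2 * A * K%:R /
                (c1bar ^+ 2 - (1 - c1bar ^+ 2) / (K%:R - 1)))) ->
  0 < dict_dist Psi Phi -> dict_dist Psi Phi <= eps ->
  (objective P Psi Phi X Rn < objective P Phi Phi X Rn)%E.
Proof.
move=> K1 dictPsi eps5 epsle dist0 distle.
have A1 := frame_constant_ge1 (Ordinal (ltnW K1)) frame.
have [g0 g1 L1] := gap_bounds K1.
move: epsle g0 g1 L1; set gamma := c1bar ^+ 2 - _; set L := ln _ => epsle g0 g1 L1.
have A0 : 0 < A by lra.
have L0 : 0 < L by lra.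
have eps0 : 0 <= eps by apply: le_trans distle; exact: ltW.
have Kp : 0 < K%:R :> R by rewrite ltr0n sphere_dim_gt0.
have heps : 2 * A * L * eps <= (1 - 2 * beta) ^+ 2.
  by move: epsle; rewrite ler_pdivlMr ?mulr_gt0// mulrC.
have heps' : 2 * A * eps <= (1 - 2 * beta) ^+ 2.
  apply: le_trans heps; rewrite -[leLHS]mulr1 -[leRHS]mulrA [L * eps]mulrC mulrA.
  by rewrite ler_wpM2l// !mulr_ge0// ltW.
pose e i := l2norm (atom_diff Psi Phi i).
have ei0 i : 0 <= e i by exact: l2norm_ge0.
have ele i : e i <= eps by exact: le_trans (le_dict_dist _ _ _) distle.
pose kap := 4 / 5 * (gamma / (2 * A * K%:R)).
have kap0 : 0 <= kap by rewrite /kap mulr_ge0// divr_ge0 ?(ltW g0)// !mulr_ge0// ltW.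
pose del i := \sum_(j | j != i) kap * (e i ^+ 2 + e j ^+ 2).
have del0 i : 0 <= del i.
  by apply: sumr_ge0 => j _; rewrite mulr_ge0// addr_ge0 ?sqr_ge0.
have dictPhi : is_dict Phi by case: frame.
have rate i j : let E2 := e i ^+ 2 + e j ^+ 2 in 0 < E2 ->
   4 * (expR 2 * expR (- (9 * (1 - 2 * beta) ^+ 2 / (4 * A * E2)))) <= kap * E2.
  move=> E2 E20; apply: (excess_rate (eps := eps)) => //.
  have : e i ^+ 2 <= eps ^+ 2 by rewrite ler_pXn2r ?nnegrE.
  have : e j ^+ 2 <= eps ^+ 2 by rewrite ler_pXn2r ?nnegrE.
  rewrite /E2; lra.
have up : (objective P Psi Phi X Rn <=
    \int[P]_w (dominant_bound Phi Psi del (X^~ w) (Rn^~ w))%:E)%E.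
  apply: objective_le => //.
  apply: filterS2 noise_le separated_ae => w rle [i [c [c2 s]]].
  rewrite (dominant_boundE _ _ _ _ (separated_dominant s)).
  have [xi c20 c2c xl h] := s.
  apply: (sum_sup_sq_le frame A1 beta_ge0 beta_lt eps5 heps' ele c20 xi c2c xl h rle).
  by move=> j ji; exact: rate.
have low : (\int[P]_w (dominant_bound Phi Phi (fun=> 0) (X^~ w) (Rn^~ w))%:E <=
    objective P Phi Phi X Rn)%E.
  by apply: objective_ge => //; exact: dominant_ae.
apply: le_lt_trans up _; apply: lt_le_trans low.
rewrite !(integral_dominant_bound frame mX mR XR symX dominant_ae hmax sphere_sum covR)//.
rewrite lte_fin -!mulr_suml ltr_pM2r ?invr_gt0//.
have := strict_gap (C := c1bar ^+ 2) sphere_dim_gt0 A1 g0 (sqr_ge0 _)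
  c1bar_sqr_le1 ei0 ele eps5 (dict_dist_gt0 dist0).
rewrite -/kap -/(del _) => gap.
(* The frame and noise terms cancel; each atom leaves [gamma * (1 - <phi_i, psi_i>^2)] minus its
   error. *)
rewrite -subr_gt0 -sumrB.
rewrite (eq_bigr (fun i => gamma * (1 - (1 - e i ^+ 2 / 2) ^+ 2) - c1bar ^+ 2 * del i)).
  by rewrite sumrB -!mulr_sumr subr_gt0.
move=> i _; rewrite -/gamma (atom_ip_diff i dictPsi dictPhi) -/(e i).
have -> : atom_ip Phi i (Phi^~ i) = 1 by exact: dict_ip1.
by ring.
Qed.

End Main.

Theorem theorem4 (R : realType) (dT : measure_display) (T : measurableType dT)
  (P : probability T R) (d K : nat) (Phi : 'M[R]_(d, K))
  (X : 'I_K -> {RV P >-> R}) (Rn : 'I_d -> {RV P >-> R})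
  (rho rho_max c1bar beta : R) :
  unit_norm_tight_frame Phi (K%:R / d%:R) ->
  (* noise *)
  indep_vec P (fun i => X i : T -> R) (fun k => Rn k : T -> R) ->
  {ae P, forall w, l2norm (fun k => Rn k w) <= rho_max} ->
  (forall k, ('E_P[Rn k] = 0)%E) ->
  (forall k l, ('E_P[Rn k \* Rn l] = (if k == l then rho ^+ 2 else 0)%:E)%E) ->
  (* coefficients: symmetric distribution on the sphere S^{K-1} *)
  {ae P, forall w, l2norm (fun i => X i w) = 1} ->
  symmetric_law P (fun i => X i : T -> R) ->
  (\int[P]_w (\big[Num.max/0]_(i < K) (X i w) ^+ 2)%:E)%E = (c1bar ^+ 2)%:E ->
  (* separation assumption *)
  beta < 1 / 2 ->
  {ae P, forall w,
     let x := fun i => X i w in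
     0 < c_ x 1 - c_ x 2 /\
     (c_ x 2 + coherence Phi * c_l1 x + rho_max) / (c_ x 1 - c_ x 2) <= beta} ->
  let J := fun Psi : 'M[R]_(d, K) =>
    objective P Psi Phi (fun i => X i : T -> R) (fun k => Rn k : T -> R) in
  let A := K%:R / d%:R : R in
  (* Phi is a local maximum *)
  (exists eps : R, 0 < eps /\
     forall Psi, is_dict Psi -> dict_dist Psi Phi <= eps -> (J Psi <= J Phi)%E) /\
  (* quantitative strict local maximum *)
  (forall eps : R, eps < 1 / 5 ->
     eps <= (1 - 2 * beta) ^+ 2 /
            (2 * A * ln (2 * A * K%:R /
                (c1bar ^+ 2 - (1 - c1bar ^+ 2) / (K%:R - 1)))) ->
     forall Psi, is_dict Psi -> 0 < dict_dist Psi Phi -> dict_dist Psi Phi <= eps ->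
     (J Psi < J Phi)%E).
Proof.
move=> frame XR noise_le _ covR sphere symX hmax beta_lt sep J A.
have mX i : measurable_fun setT (X i : T -> R) by [].
have mR k : measurable_fun setT (Rn k : T -> R) by [].
have cov k l : (\int[P]_w (Rn k w * Rn l w)%:E)%E = (if k == l then rho ^+ 2 else 0)%:E.
  by rewrite -covR unlock.
have K0 : (0 < K)%N := sphere_dim_gt0 sphere.
have strict eps : eps < 1 / 5 ->
     eps <= (1 - 2 * beta) ^+ 2 / (2 * A * ln (2 * A * K%:R /
                (c1bar ^+ 2 - (1 - c1bar ^+ 2) / (K%:R - 1)))) ->
     forall Psi, is_dict Psi -> 0 < dict_dist Psi Phi -> dict_dist Psi Phi <= eps ->
     (J Psi < J Phi)%E.
  move=> eps5 epsle Psi dictPsi dist0 distle.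
  have [K1|K1] := ltnP 1 K.
    exact: (strict_local_max frame mX mR XR symX noise_le cov sphere hmax
      beta_lt sep K1 dictPsi eps5 epsle dist0 distle).
  (* With a single atom no other dictionary lies within [1 / 5], contradicting the positive
     distance. *)
  have K1' : K = 1%N by apply/eqP; rewrite eqn_leq K1 K0.
  have := single_atom_rigid K1' frame dictPsi (le_lt_trans distle eps5).
  by rewrite leNgt dist0.
split; last exact: strict.
(* For [1 < K] the radius is the minimum of [1 / 10] and the explicit bound, positive because
   [beta < 1 / 2] and the logarithm is at least 1. For [K = 1] the radius is [1 / 10], by
   rigidity. *)
have [eps [eps0 eps5 H]] : exists eps : R, [/\ 0 < eps, eps < 1 / 5 &
    (1 < K)%N -> eps <= (1 - 2 * beta) ^+ 2 / (2 * A * ln (2 * A * K%:R /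
                (c1bar ^+ 2 - (1 - c1bar ^+ 2) / (K%:R - 1))))].
  have [K1|K1] := ltnP 1 K; last by exists (1 / 10); split => //; lra.
  have [_ _ L1] := gap_bounds frame mX noise_le sphere hmax beta_lt sep K1.
  have A1 := frame_constant_ge1 (Ordinal K0) frame.
  set B := _ ^+ 2 / (2 * A * _); have B0 : 0 < B.
    apply: divr_gt0; first by apply: exprn_gt0; lra.
    apply: mulr_gt0; last exact: lt_le_trans ltr01 L1.
    by apply: mulr_gt0 => //; exact: lt_le_trans ltr01 A1.
  have h0 : 0 < 1 / 10 :> R by lra.
  have h5 : 1 / 10 < 1 / 5 :> R by lra.
  exists (Num.min (1 / 10) B); split.
  - by rewrite lt_min h0 B0.
  - by rewrite gt_min h5.
  - by move=> _; rewrite ge_min lexx orbT.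
exists eps; split => // Psi dictPsi distle.
have [dist0|] := ltP 0 (dict_dist Psi Phi); last by move=> /dict_dist_le0 ->.
have [K1|K1] := ltnP 1 K; first exact/ltW/(strict eps eps5 (H K1)).
have K1' : K = 1%N by apply/eqP; rewrite eqn_leq K1 K0.
have := single_atom_rigid K1' frame dictPsi (le_lt_trans distle eps5).
by rewrite leNgt dist0.
Qed.
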